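(* Let $\gamma\in C^{1,1}(\mathbb{S}_{L},\mathbb{R}^{d})$ be parametrised by arc length, and let $c,\overline{c}>0$. Then for every $\varepsilon\in(0,1)$ there is a $C_{\varepsilon}>0$ such that $$|\mathcal{E}(\gamma)-\mathcal{E}_{n}(p_{n})|\leq\frac{C_{\varepsilon}}{n^{1-\varepsilon}}$$ for every inscribed polygon $p_{n}$ given by a subdivision $b_{k}$, $k=1,\dots,n$, of $\mathbb{S}_{L}$ such that $$\frac{c}{n}\leq\min_{k=1,\dots,n}|\gamma(b_{k+1})-\gamma(b_{k})|\leq\max_{k=1,\dots,n}|\gamma(b_{k+1})-\gamma(b_{k})|\leq\frac{\overline{c}}{n}.$$
   Context: $\mathbb{S}_{L}$ is the circle of length $L>0$, and $d(\cdot,\cdot)$ denotes the intrinsic (shortest arc) metric on a circle. For a closed rectifiable curve $\gamma:\mathbb{S}_{L}\to\mathbb{R}^{d}$ of length $L$ parametrised by arc length, the Möbius energy is $$\mathcal{E}(\gamma)=\int_{\mathbb{S}_{L}}\int_{\mathbb{S}_{L}}\Big(\frac{1}{|\gamma(t)-\gamma(s)|^{2}}-\frac{1}{d(t,s)^{2}}\Big)\,ds\,dt.$$ A subdivision $b_{1},\dots,b_{n}$ of $\mathbb{S}_{L}$ consists of $n$ points in consecutive (cyclic) order, with indices mod $n$ (so $b_{n+1}=b_{1}$). The inscribed polygon given by it is the closed polygon with consecutive vertices $\gamma(b_{1}),\dots,\gamma(b_{n})$, parametrised by arc length over $\mathbb{S}_{\tilde L}$, where $\tilde L=\sum_{k=1}^n|\gamma(b_{k+1})-\gamma(b_{k})|$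 is its length. For a closed polygon $p$ with $n$ segments and length $\tilde L$, parametrised by arc length over $\mathbb{S}_{\tilde L}$ with vertices $p(a_{1}),\dots,p(a_{n})$ at consecutive points $a_{1},\dots,a_{n}\in\mathbb{S}_{\tilde L}$ (indices mod $n$), the discrete Möbius energy is $$\mathcal{E}_{n}(p)=\sum_{\substack{i,j=1\\ i\neq j}}^{n}\Big(\frac{1}{|p(a_{j})-p(a_{i})|^{2}}-\frac{1}{d(a_{j},a_{i})^{2}}\Big)\,d(a_{i+1},a_{i})\,d(a_{j+1},a_{j}),$$ where $d$ is the intrinsic metric of $\mathbb{S}_{\tilde L}$. The constant $C_{\varepsilon}$ may depend on $\gamma$, $c$, $\overline{c}$ and $\varepsilon$, but not on $n$ or the subdivision.
   Formalization: The curve γ is additionally assumed simple (injective on S_L); for a self-intersecting γ, such as a figure eight, E(γ)=∞ while E_n(p_n) is finite for subdivisions avoiding the double point, so the inequality fails. *)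

(* Defs.v *)
(* MathComp-Analysis *)
From HB Require Import structures.
From mathcomp Require Import all_boot all_order all_algebra.
From mathcomp Require Import all_classical all_reals all_analysis.

Set Implicit Arguments.
Unset Strict Implicit.
Unset Printing Implicit Defensive.

Import Order.TTheory GRing.Theory Num.Theory.
Import numFieldNormedType.Exports.

Local Open Scope classical_set_scope.
Local Open Scope ring_scope.

(* The library norm on ['rV[R]_d] is the max norm, so the Euclidean norm of R^d
   is defined here. *)
Definition enorm (R : realType) (d : nat) (v : 'rV[R]_d) : R :=
  Num.sqrt (\sum_(i < d) v ord0 i ^+ 2).

(* Points of the circle R/LZ are given by real representatives, and maps on the
   circle by L-periodic maps on R.  [arc L s t], in [0, L), is the length of the
   positively oriented arc from s to t; the complementary arc has length
   [L - arc L s t]. *)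
Definition arc (R : realType) (L s t : R) : R :=
  (t - s) - L * (Num.floor ((t - s) / L))%:~R.

Definition circle_dist (R : realType) (L s t : R) : R :=
  Num.min (arc L s t) (L - arc L s t).

(* The Lipschitz condition is with respect to the max norm, which is equivalent
   to the Euclidean one; it contains the continuity of the derivative. *)
Definition C11_closed_curve (R : realType) (d : nat) (L : R)
    (gamma : R -> 'rV[R]_d) : Prop :=
  [/\ periodic gamma L,
      forall t, derivable gamma t 1 &
      exists K : R, K.-lipschitz (derive1 gamma)].

Definition arclength_parametrised (R : realType) (d : nat)
    (gamma : R -> 'rV[R]_d) : Prop :=
  forall t, enorm (derive1 gamma t) = 1.

Definition simple_closed (R : realType) (d : nat) (L : R)
    (gamma : R -> 'rV[R]_d) : Prop :=
  {in `[0, L[ &, injective gamma}.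

(* [0^-1 = 0] in R, so the integrand is 0 on the diagonal, a null set. *)
Definition mobius_energy (R : realType) (d : nat) (L : R)
    (gamma : R -> 'rV[R]_d) : \bar R :=
  (\int[lebesgue_measure]_(t in `[0%R, L])
    \int[lebesgue_measure]_(s in `[0%R, L])
      ((enorm (gamma t - gamma s) ^+ 2)^-1 -
       (circle_dist L t s ^+ 2)^-1)%:E)%E.

(* n distinct points of R/LZ in cyclic order, by representatives
   b 0 < ... < b (n-1) < b 0 + L. *)
Definition subdivision (R : realType) (L : R) (n : nat) (b : 'I_n -> R) : Prop :=
  (forall i j : 'I_n, (i < j)%N -> b i < b j) /\
  (forall i j : 'I_n, b j < b i + L).

(* Index arithmetic is mod n: [ordS k] is the cyclic successor of k. *)
Definition closed_polygon (R : realType) (d : nat) (l : R) (n : nat)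
    (p : R -> 'rV[R]_d) (a : 'I_n -> R) : Prop :=
  [/\ periodic p l,
      subdivision l a &
      forall k : 'I_n, exists2 u : 'rV[R]_d, enorm u = 1 &
        forall t : R, 0 <= t <= arc l (a k) (a (ordS k)) ->
          p (a k + t) = p (a k) + t *: u].

Definition discrete_mobius_energy (R : realType) (d : nat) (l : R) (n : nat)
    (p : R -> 'rV[R]_d) (a : 'I_n -> R) : R :=
  \sum_(i < n) \sum_(j < n | i != j)
    ((enorm (p (a j) - p (a i)) ^+ 2)^-1 - (circle_dist l (a j) (a i) ^+ 2)^-1)
    * circle_dist l (a (ordS i)) (a i) * circle_dist l (a (ordS j)) (a j).

Definition inscribed_length (R : realType) (d : nat) (gamma : R -> 'rV[R]_d)
    (n : nat) (b : 'I_n -> R) : R :=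
  \sum_(k < n) enorm (gamma (b (ordS k)) - gamma (b k)).

(* p is an arc length parametrisation, of period [inscribed_length gamma b], of
   the closed polygon with consecutive vertices gamma (b k), and p (a k) is the
   vertex gamma (b k). *)
Definition inscribed_polygon (R : realType) (d : nat) (gamma : R -> 'rV[R]_d)
    (n : nat) (b : 'I_n -> R) (p : R -> 'rV[R]_d) (a : 'I_n -> R) : Prop :=
  closed_polygon (inscribed_length gamma b) p a /\
  (forall k : 'I_n, p (a k) = gamma (b k)).

(* Main.v *)
(* Write g(t,s) = |gamma t - gamma s|^2. For unit vectors 1 - <u, w> = |u - w|^2/2,
   so the Lipschitz bound on gamma' and the mean value theorem show that the
   defect (t-s)^2 - g(t,s) lies between 0 and H (t-s)^4 and has Lipschitz
   constant H X^3 on |t-s| <= X. With the bi-Lipschitz bound for gamma on the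
   circle, the integrand F = 1/g - 1/d^2 is bounded and has variation O(h/d) when
   its arguments move by h.
   With mesh h = O(1/n), replacing F on the cell (i, j) by its value at (b_i, b_j)
   costs O(n^-3/d(b_i,b_j)) for i <> j and O(n^-2) for i = j. Since an edge and its
   arc differ by O(n^-3), replacing arc lengths by edge lengths also costs
   O(n^-3/d(b_i,b_j)). As d(b_i,b_j) is at least (c/n) min(|i-j|, n-|i-j|), the
   errors add up to O((1 + ln n)/n). *)
Require Import Defs.
From HB Require Import structures.
From mathcomp Require Import all_boot all_order all_algebra.
From mathcomp Require Import all_classical all_reals all_analysis.
From mathcomp Require Import measurable_realfun zify ring lra.

Set Implicit Arguments.
Unset Strict Implicit.
Unset Printing Implicit Defensive.

Import Order.TTheory GRing.Theory Num.Theory.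
Import numFieldNormedType.Exports.
Local Open Scope classical_set_scope.
Local Open Scope ring_scope.

(** * The chord defect of a C^{1,1} curve *)

(** The hypotheses bound chords only, so even the shortness of the arcs needs proof. It rests on the
    chord-arc inequality |gamma t - gamma s|^2 >= k d^2, which comes from the defect bound for
    nearby points and from injectivity with compactness for all others. Constants must serve every n
    >= 2 and not only large n, so arcs longer than half of the circle and factors 1 - O(n^-2) of
    either sign have to be handled. The intrinsic distance has a kink at antipodal pairs. Pairs are
    therefore lifted to the line, where the defect estimates apply, and the change of lift is
    estimated separately. Since F >= 0, the double integral is squeezed by monotonicity between the
    integrals of two nonnegative step functions, which also yields its finiteness. The logarithm is
    absorbed at the very end by n^eps. *)

Lemma enorm_sqr (R : realType) (d : nat) (v : 'rV[R]_d) :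
  enorm v ^+ 2 = \sum_(i < d) v ord0 i ^+ 2.
Proof. by rewrite sqr_sqrtr// sumr_ge0// => i _; rewrite sqr_ge0. Qed.

Lemma enorm_ge0 (R : realType) (d : nat) (v : 'rV[R]_d) : 0 <= enorm v.
Proof. exact: sqrtr_ge0. Qed.

Lemma enormZ (R : realType) (d : nat) (a : R) (v : 'rV[R]_d) :
  0 <= a -> enorm (a *: v) = a * enorm v.
Proof.
move=> a0; rewrite /enorm; under eq_bigr do rewrite mxE exprMn.
by rewrite -mulr_sumr sqrtrM ?sqr_ge0// sqrtr_sqr ger0_norm.
Qed.

(** The order of [a] and [b] is left open because the moving end of a chord may lie on either side
    of the fixed one. *)
Lemma mean_value (R : realType) (f df : R -> R) (a b : R) :
  (forall x : R, is_derive x (1 : R) f (df x)) ->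
  exists2 c, (a <= c <= b) || (b <= c <= a) & f b - f a = df c * (b - a).
Proof.
move=> fdf.
have cf A : {within A, continuous f}.
  apply: continuous_subspaceT => x.
  by apply/differentiable_continuous/derivable1_diffP; have [] := fdf x.
have [ab|ba] := leP a b.
  have [c] := MVT_segment ab (fun x _ => fdf x) (cf _).
  by rewrite in_itv/= => cab E; exists c => //; rewrite cab.
have [c] := MVT_segment (ltW ba) (fun x _ => fdf x) (cf _).
rewrite in_itv/= => cab E; exists c; first by rewrite cab orbT.
by rewrite -(opprB (f a)) E; ring.
Qed.

Section curve.
Variables (R : realType) (d : nat) (gamma : R -> 'rV[R]_d) (K : R).
Hypothesis dgamma : forall t, derivable gamma t 1.
Hypothesis K_lip : K.-lipschitz (derive1 gamma).
Hypothesis gamma_arclength : arclength_parametrised gamma.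

Let x i t := gamma t ord0 i.
Let v i t := derive1 gamma t ord0 i.
(** The max norm bounds each coordinate of the velocity difference by [K]; summing [d] squares gives
    the Euclidean constant. *)
Let H := d%:R * K ^+ 2.

Let is_derive_x i (t : R) : is_derive t (1 : R) (x i) (v i t).
Proof.
apply: DeriveDef; first exact: (derivable_mxP gamma t 1).1.
by rewrite /v derive1E derive_mx// mxE.
Qed.

Let sum_v_sqr t : \sum_(i < d) v i t ^+ 2 = 1.
Proof. by rewrite -enorm_sqr gamma_arclength expr1n. Qed.

Let v_lip t s : \sum_(i < d) (v i t - v i s) ^+ 2 <= H * (t - s) ^+ 2.
Proof.
have vi i : (v i t - v i s) ^+ 2 <= K ^+ 2 * (t - s) ^+ 2.
  have /= le1 := @K_lip (t, s) (conj Logic.I Logic.I).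
  have le2 : `|v i t - v i s| <= K * `|t - s|.
    apply: le_trans le1; rewrite [leRHS]/Num.Def.normr/= mx_normrE.
    have := @le_bigmax _ _ _ 0
      (fun i => `|(derive1 gamma t - derive1 gamma s) i.1 i.2|) (ord0, i).
    by rewrite !mxE.
  rewrite -(real_normK (num_real (v i t - v i s))).
  rewrite -(real_normK (num_real (t - s))) -exprMn.
  by rewrite lerXn2r ?nnegrE// (le_trans _ le2).
rewrite (le_trans (ler_sum _ (fun i _ => vi i)))//.
by rewrite sumr_const card_ord -[leLHS]mulr_natl mulrA.
Qed.

Lemma lip_const_ge0 : 0 <= H.
Proof. by rewrite mulr_ge0// sqr_ge0. Qed.

(* [1 - <u, w> = |u - w|^2 / 2] for unit vectors. *)
Let tangent_chord t y : exists2 e, 0 <= e <= H * (t - y) ^+ 2 / 2 &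
  (t - y) - \sum_(i < d) v i t * (x i t - x i y) = e * (t - y).
Proof.
pose psi y := (t - y) - \sum_(i < d) v i t * (x i t - x i y).
pose dpsi y := - 1 + \sum_(i < d) v i t * v i y.
have dpsiP (z : R) : is_derive z (1 : R) psi (dpsi z).
  pose dd i := v i t * v i z.
  have -> : psi = (cst t - id) - \sum_(i < d) (fun z => v i t * (x i t - x i z)).
    by apply/funext => u; rewrite fctE /psi fct_sumE.
  have -> : dpsi z = (0 - 1) - \sum_(i < d) - dd i by rewrite sumrN opprK sub0r.
  apply: is_deriveB; apply: is_derive_sum => i.
  have := is_deriveZ (v i t) (is_deriveB (is_derive_cst (x i t) z 1) (is_derive_x i z)).
  by rewrite sub0r scalerN.
have [c cty psiE] := mean_value t y dpsiP.
have psit : psi t = 0.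
  by rewrite /psi subrr big1 ?subr0// => i _; rewrite subrr mulr0.
have dpsiE : - dpsi c = (\sum_(i < d) (v i t - v i c) ^+ 2) / 2.
  under eq_bigr do rewrite sqrrB -mulr_natr.
  rewrite big_split sumrB/= -mulr_suml (sum_v_sqr t) (sum_v_sqr c) /dpsi.
  by move: (\sum_(i < d) _) => S; field.
exists (- dpsi c).
  rewrite dpsiE divr_ge0//= ?sumr_ge0// => [|i _]; last exact: sqr_ge0.
  rewrite ler_pM2r// (le_trans (v_lip t c))// ler_wpM2l ?lip_const_ge0//.
  by case/orP: cty => /andP[? ?]; nra.
by rewrite -/(psi y) -[psi y]subr0 -psit psiE; ring.
Qed.

(** Defined on the line: a pair on the circle is first lifted to representatives whose difference
    realises the intrinsic distance. *)
Definition chord_defect t s := (t - s) ^+ 2 - enorm (gamma t - gamma s) ^+ 2.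

(** The derivative of the defect in its first argument is twice the quantity of [tangent_chord]. The
    factor [e >= 0] is kept apart so that the sign of the increment remains visible. *)
Let chord_defect_incr t t' s : exists2 c, (t <= c <= t') || (t' <= c <= t) &
  exists2 e, 0 <= e <= H * (c - s) ^+ 2 &
  chord_defect t' s - chord_defect t s = e * (c - s) * (t' - t).
Proof.
pose dd t := 2 * ((t - s) - \sum_(i < d) v i t * (x i t - x i s)).
have ddP (z : R) : is_derive z (1 : R) (chord_defect ^~ s) (dd z).
  have -> : chord_defect ^~ s = (id - cst s) ^+ 2 - \sum_(i < d) (x i - cst (x i s)) ^+ 2.
    apply/funext => u; rewrite /chord_defect enorm_sqr fctE fct_sumE.
    by congr (_ - _); apply: eq_bigr => i _; rewrite !mxE.
  have -> : dd z = (2 * (z - s)) *: (1 - 0) - \sum_(i < d) (2 * (x i z - x i s)) *: (v i z - 0).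
    rewrite /dd mulrBr subr0 mulr_sumr [_ *: _]mulr1; congr (_ - _).
    by apply: eq_bigr => i _; rewrite subr0 /GRing.scale/=; ring.
  apply: is_deriveB; apply: is_derive_sum => i.
  have := is_deriveB (is_derive_x i z) (is_derive_cst (x i s) z 1).
  exact: is_deriveX.
have [c cP ->] := mean_value t t' ddP; exists c => //.
have [e /andP[e0 eH] cE] := tangent_chord c s.
exists (2 * e); first by apply/andP; split; [rewrite mulr_ge0|lra].
by rewrite /dd cE; ring.
Qed.

(** The defect vanishes on the diagonal, and an intermediate point c between s and t gives 0 <= (c -
    s)(t - s) <= (t - s)^2. *)
Lemma chord_defect_bounds t s : 0 <= chord_defect t s <= H * (t - s) ^+ 4.
Proof.
have [c cP [e /andP[e0 eH] E]] := chord_defect_incr s t s.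
have <- : chord_defect t s - chord_defect s s = chord_defect t s.
  by rewrite {2}/chord_defect !subrr enorm_sqr big1 ?expr0n ?subrr ?subr0// => i _;
     rewrite mxE expr0n.
rewrite E -mulrA.
have p0 : 0 <= (c - s) * (t - s) by case/orP: cP => /andP[? ?]; nra.
have p1 : (c - s) * (t - s) <= (t - s) ^+ 2 by case/orP: cP => /andP[? ?]; nra.
have p2 : (c - s) ^+ 2 <= (t - s) ^+ 2 by case/orP: cP => /andP[? ?]; nra.
rewrite mulr_ge0//= (_ : 4%N = (2 + 2)%N)// exprD [leRHS]mulrA ler_pM//.
by rewrite (le_trans eH)// ler_wpM2l// lip_const_ge0.
Qed.

Lemma chord_defectC t s : chord_defect t s = chord_defect s t.
Proof.
rewrite /chord_defect !enorm_sqr; congr (_ - _); first ring.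
by apply: eq_bigr => i _; rewrite !mxE; ring.
Qed.

(** One argument is moved at a time, the second by symmetry; the three hypotheses bound the pairs
    met on the way. *)
Lemma chord_defect_lip t s t' s' (X : R) :
  `|t - s| <= X -> `|t' - s| <= X -> `|t' - s'| <= X ->
  `|chord_defect t' s' - chord_defect t s| <= H * X ^+ 3 * (`|t' - t| + `|s' - s|).
Proof.
move=> h1 h2 h3.
have incr u u' w : `|u - w| <= X -> `|u' - w| <= X ->
    `|chord_defect u' w - chord_defect u w| <= H * X ^+ 3 * `|u' - u|.
  move=> k1 k2; have [c cP [e /andP[e0 eH] ->]] := chord_defect_incr u u' w.
  rewrite !normrM ler_wpM2r// (ger0_norm e0).
  have cX : `|c - w| <= X.
    by move: k1 k2; rewrite !ler_norml => /andP[? ?] /andP[? ?];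
      case/orP: cP => /andP[? ?]; lra.
  rewrite exprSr mulrA ler_pM// (le_trans eH)// ler_wpM2l ?lip_const_ge0//.
  by rewrite -[_ ^+ 2]ger0_norm ?sqr_ge0// normrX lerXn2r// nnegrE (le_trans _ cX).
rewrite (_ : _ - _ = (chord_defect t' s' - chord_defect t' s) +
  (chord_defect t' s - chord_defect t s)); last by ring.
rewrite (le_trans (ler_normD _ _))// [in leRHS]addrC mulrDr lerD ?incr//.
by rewrite ![chord_defect t' _]chord_defectC incr// distrC.
Qed.

End curve.

(** * The intrinsic distance of a circle *)

Section circle.
Variables (R : realType) (L : R).
Hypothesis L0 : 0 < L.

Lemma arc_bounds s t : 0 <= Defs.arc L s t < L.
Proof.
have /andP[] := floor_itv ((t - s) / L).
rewrite ler_pdivlMr// ltr_pdivrMr// intrD rmorph1 /Defs.arc => ? ?.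
by apply/andP; split; lra.
Qed.

Lemma arc_unique (m : int) s t :
  0 <= t - s + L * m%:~R < L -> Defs.arc L s t = t - s + L * m%:~R.
Proof.
move=> /andP[h0 h1]; have -> : Defs.arc L s t = t - s - L * (- m)%:~R.
  congr (_ - L * _%:~R); apply: floor_def.
  rewrite intrD !rmorphN rmorph1 ler_pdivlMr// ltr_pdivrMr//.
  by apply/andP; split; lra.
by rewrite rmorphN/= mulrN opprK.
Qed.

(** With [circle_dist_le] this makes the intrinsic distance the minimum of |s - t + L m| over
    integers m, from which symmetry, periodicity and the Lipschitz bound follow. *)
Lemma circle_dist_lift s t :
  exists m : int, circle_dist L s t = `|s - t + L * m%:~R|.
Proof.
have /andP[a0 aL] := arc_bounds s t; rewrite /circle_dist.
set k := Num.floor ((t - s) / L).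
have aE : Defs.arc L s t = t - s - L * k%:~R by [].
have [_|_] := leP (Defs.arc L s t) (L - Defs.arc L s t).
  exists k; rewrite -normrN (_ : - (_ + _) = Defs.arc L s t) ?ger0_norm// aE; ring.
exists (k + 1); rewrite intrD rmorph1 (_ : _ + _ = L - Defs.arc L s t); last first.
  by rewrite aE; ring.
by rewrite ger0_norm// subr_ge0 ltW.
Qed.

Lemma circle_dist_le (m : int) s t : circle_dist L s t <= `|s - t + L * m%:~R|.
Proof.
have /andP[a0 aL] := arc_bounds s t.
pose k := Num.floor ((t - s) / L).
have -> : s - t + L * m%:~R = L * (m - k)%:~R - Defs.arc L s t.
  by rewrite rmorphB/= /Defs.arc -/k; ring.
rewrite /circle_dist ge_min; have [h|h] := leP (m - k) 0.
  have h' : (m - k)%:~R <= 0 :> R by rewrite lerz0.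
  by rewrite ler0_norm ?subr_le0; [|nra]; apply/orP; left; nra.
have h' : 1 <= (m - k)%:~R :> R by rewrite -[1]/(1%:~R) ler_int.
by rewrite ger0_norm ?subr_ge0; [|nra]; apply/orP; right; nra.
Qed.

Lemma circle_dist_ge0 s t : 0 <= circle_dist L s t.
Proof. by have [m ->] := circle_dist_lift s t. Qed.

Lemma circle_dist_half s t : circle_dist L s t <= L / 2.
Proof. by rewrite /circle_dist ge_min; case: leP => //= ?; lra. Qed.

Lemma circle_distC s t : circle_dist L s t = circle_dist L t s.
Proof.
suff le s' t' : circle_dist L s' t' <= circle_dist L t' s'.
  by apply/eqP; rewrite eq_le !le.
have [m ->] := circle_dist_lift t' s'.
rewrite (le_trans (circle_dist_le (- m) _ _))// -normrN rmorphN/=.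
by rewrite (_ : - (_ + _) = t' - s' + L * m%:~R)//; ring.
Qed.

Lemma circle_dist_shift (k m : int) s t :
  circle_dist L (s + L * k%:~R) (t + L * m%:~R) = circle_dist L s t.
Proof.
suff le (k' m' : int) s' t' :
    circle_dist L (s' + L * k'%:~R) (t' + L * m'%:~R) <= circle_dist L s' t'.
  apply/eqP; rewrite eq_le le/=.
  rewrite -[in leLHS](addrK (L * k%:~R) s) -[in leLHS](addrK (L * m%:~R) t).
  by rewrite -!mulrN -!rmorphN; exact: le.
have [j ->] := circle_dist_lift s' t'.
rewrite (le_trans (circle_dist_le (j + m' - k') _ _))//.
rewrite (_ : _ + L * (j + m' - k')%:~R = s' - t' + L * j%:~R)//.
by rewrite rmorphB rmorphD/=; ring.
Qed.

(** Any other representative differs by at least L, hence stays at distance at least L - L/2. *)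
Lemma circle_dist_near s t : `|s - t| <= L / 2 -> circle_dist L s t = `|s - t|.
Proof.
move=> st; apply/eqP; rewrite eq_le; apply/andP; split.
  by have := circle_dist_le 0 s t; rewrite mulr0 addr0.
have [m ->] := circle_dist_lift s t.
have [->|m0] := eqVneq m 0; first by rewrite mulr0 addr0.
have m1 : 1 <= `|m%:~R| :> R.
  by rewrite -intr_norm -[1]/(1%:~R) ler_int -gtz0_ge1 normr_gt0.
have : `|L * m%:~R| <= `|s - t + L * m%:~R| + `|s - t|.
  by rewrite -[in leRHS](normrN (s - t)) -[in leLHS](addKr (s - t) (L * _)) addrC ler_normD.
rewrite normrM (gtr0_norm L0) => ?.
have : L <= L * `|m%:~R| by rewrite ler_peMr// ltW.
lra.
Qed.

Lemma circle_dist_lip s t s' t' :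
  circle_dist L s' t' <= circle_dist L s t + `|s' - s| + `|t' - t|.
Proof.
have [m ->] := circle_dist_lift s t.
rewrite (le_trans (circle_dist_le m s' t'))//.
have -> : s' - t' + L * m%:~R = (s - t + L * m%:~R) + (s' - s) - (t' - t) by ring.
by rewrite (le_trans (ler_normB _ _))// lerD2r ler_normD.
Qed.

Lemma periodicz (T : Type) (f : R -> T) (m : int) t :
  (forall u, f (u + L) = f u) -> f (t + L * m%:~R) = f t.
Proof.
move=> fL; have nat_shift (n : nat) u : f (u + L * n%:R) = f u.
  elim: n => [|n ih]; first by rewrite mulr0 addr0.
  by rewrite -addn1 natrD mulrDr mulr1 addrA fL.
case: m => n; first exact: nat_shift.
by rewrite NegzE -[in RHS](subrK (L * n.+1%:R) t) nat_shift rmorphN/= mulrN.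
Qed.

End circle.

(** * The Moebius integrand *)

Lemma ler_norm_div (R : realFieldType) (p q P Q : R) :
  `|p| <= P -> 0 < Q -> Q <= q -> `|p / q| <= P / Q.
Proof.
move=> pP Q0 Qq; have q0 : 0 < q by exact: lt_le_trans Qq.
rewrite normrM normfV (gtr0_norm q0) ler_pM ?invr_ge0 ?(ltW q0)//.
by rewrite lef_pV2.
Qed.

(** With D a distance and D^2 - f a squared chord, the difference is f / ((D^2 - f) D^2), whose
    numerator and denominator are both of order D^4. *)
Lemma invf_sub_bounds (R : realFieldType) (H k D f : R) :
  0 <= H -> 0 < k -> 0 <= D -> 0 <= f <= H * D ^+ 4 -> k * D ^+ 2 <= D ^+ 2 - f ->
  0 <= (D ^+ 2 - f)^-1 - (D ^+ 2)^-1 <= H / k.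
Proof.
move=> H0 k0 D0 /andP[f0 fH] kD.
(* On the diagonal f = 0 as well, so both inverses are the same and cancel. *)
have [E|Dn0] := eqVneq D 0.
  have -> : f = 0 by apply/eqP; rewrite eq_le f0 (le_trans fH)// E expr0n mulr0.
  by rewrite subr0 subrr lexx divr_ge0// ltW.
have Dgt0 : 0 < D by rewrite lt_def Dn0.
have D2 : 0 < D ^+ 2 by rewrite exprn_gt0.
have g0 : 0 < D ^+ 2 - f by apply: lt_le_trans kD; rewrite mulr_gt0.
have -> : (D ^+ 2 - f)^-1 - (D ^+ 2)^-1 = f / ((D ^+ 2 - f) * D ^+ 2).
  by field; rewrite Dn0 gt_eqF.
rewrite divr_ge0 ?mulr_ge0 ?(ltW g0) ?(ltW D2)//=.
have -> : H / k = H * D ^+ 4 / (k * D ^+ 2 * D ^+ 2).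
  by field; rewrite Dn0 gt_eqF.
rewrite -[leLHS]ger0_norm; last by rewrite divr_ge0 ?mulr_ge0 ?(ltW g0) ?(ltW D2).
by apply: ler_norm_div; rewrite ?ger0_norm ?mulr_gt0// ler_pM2r.
Qed.

(** [D], [f] and [D1], [f1] are distance and defect before and after a displacement by [h]. The
    condition 4 h <= D gives D/2 <= D1 <= 3/2 D and so keeps the denominators comparable. *)
Lemma invf_sub_lip (R : realFieldType) (L H k D D1 f f1 h : R) :
  0 <= H -> 0 < k -> 0 < D <= L -> 0 <= h -> 4 * h <= D -> `|D1 - D| <= 2 * h ->
  0 <= f <= H * D ^+ 4 -> 0 <= f1 ->
  `|f1 - f| <= H * (2 * D) ^+ 3 * (2 * h) ->
  k * D ^+ 2 <= D ^+ 2 - f -> k * (D / 2) ^+ 2 <= D1 ^+ 2 - f1 ->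
  `|((D1 ^+ 2 - f1)^-1 - (D1 ^+ 2)^-1) - ((D ^+ 2 - f)^-1 - (D ^+ 2)^-1)| <=
  (16 ^+ 2 * H / k + 16 * H * (17 + 16 * H * L ^+ 2) / k ^+ 2) * (h / D).
Proof.
move=> H0 k0 /andP[D0 DL] h0 hD DD /andP[f0 fH] f10 ff kg kg1.
move: DD; rewrite ler_norml => /andP[DD1 DD2].
have D10 : 0 < D1 by lra.
have D2 : 0 < D ^+ 2 by rewrite exprn_gt0.
have D12 : 0 < D1 ^+ 2 by rewrite exprn_gt0.
set g := D ^+ 2 - f in kg *; set g1 := D1 ^+ 2 - f1 in kg1 *.
have g0 : 0 < g by apply: lt_le_trans kg; rewrite mulr_gt0.
have g10 : 0 < g1 by apply: lt_le_trans kg1; rewrite mulr_gt0// exprn_gt0// divr_gt0.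
(* As 1/g - 1/D^2 = f / (g D^2), the first term carries the change of the numerator and the second
   that of the denominator. *)
have -> : (g1^-1 - (D1 ^+ 2)^-1) - (g^-1 - (D ^+ 2)^-1) =
    (f1 - f) / (g1 * D1 ^+ 2) +
    (f * ((g - g1) * D ^+ 2 + g1 * (D ^+ 2 - D1 ^+ 2))) / ((g1 * D1 ^+ 2) * (g * D ^+ 2)).
  rewrite (_ : f1 = D1 ^+ 2 - g1); last by rewrite /g1; ring.
  rewrite (_ : f = D ^+ 2 - g); last by rewrite /g; ring.
  by field; rewrite !gt_eqF.
have Q0 : 0 < k * D ^+ 4 / 16 by rewrite divr_gt0// mulr_gt0// exprn_gt0.
have Q1 : k * D ^+ 4 / 16 <= g1 * D1 ^+ 2.
  rewrite (_ : k * D ^+ 4 / 16 = k * (D / 2) ^+ 2 * (D / 2) ^+ 2); last by field.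
  have e : (D / 2) ^+ 2 <= D1 ^+ 2 by rewrite lerXn2r ?nnegrE//; lra.
  by apply: (ler_pM _ _ kg1 e); rewrite ?sqr_ge0// mulr_ge0 ?sqr_ge0// ltW.
have Q2 : k * D ^+ 4 <= g * D ^+ 2.
  by rewrite (_ : k * D ^+ 4 = k * D ^+ 2 * D ^+ 2) ?ler_pM2r//; ring.
have dX : `|D ^+ 2 - D1 ^+ 2| <= 5 * h * D.
  rewrite ler_norml; apply/andP; split; nra.
have dg : `|g - g1| <= h * D * (5 + 16 * H * L ^+ 2).
  have -> : g - g1 = (D ^+ 2 - D1 ^+ 2) + (f1 - f) by rewrite /g/g1; ring.
  rewrite (le_trans (ler_normD _ _))// mulrDr lerD//.
    by rewrite (_ : h * D * 5 = 5 * h * D)//; ring.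
  rewrite (le_trans ff)// (_ : H * (2 * D) ^+ 3 * (2 * h) = h * D * (16 * H * D ^+ 2)); last by ring.
  rewrite ler_wpM2l ?mulr_ge0 ?(ltW D0)// ler_wpM2l ?mulr_ge0//.
  by rewrite lerXn2r ?nnegrE ?(ltW D0)// (le_trans _ DL) // ltW.
have g1D : g1 <= 9 / 4 * D ^+ 2.
  have : D1 ^+ 2 <= (3 / 2 * D) ^+ 2 by rewrite lerXn2r ?nnegrE//; lra.
  by rewrite /g1; lra.
(* The sum 5 + 9/4 * 5 = 65/4 is rounded up to 17, which leaves the slack 3/4 below. *)
have N2 : `|(g - g1) * D ^+ 2 + g1 * (D ^+ 2 - D1 ^+ 2)| <=
    h * D ^+ 3 * (17 + 16 * H * L ^+ 2).
  rewrite (le_trans (ler_normD _ _))// (normrM _ (D ^+ 2)) (normrM g1) (gtr0_norm D2) (gtr0_norm g10).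
  have e1 : `|g - g1| * D ^+ 2 <= h * D * (5 + 16 * H * L ^+ 2) * D ^+ 2 by rewrite ler_pM2r.
  have e2 : g1 * `|D ^+ 2 - D1 ^+ 2| <= 9 / 4 * D ^+ 2 * (5 * h * D) by rewrite ler_pM// ltW.
  have e3 : 0 <= h * D ^+ 3 by rewrite mulr_ge0// exprn_ge0// ltW.
  rewrite (le_trans (lerD e1 e2))// -subr_ge0.
  rewrite (_ : _ - _ = 3 / 4 * (h * D ^+ 3)); last by field.
  by rewrite mulr_ge0.
rewrite (le_trans (ler_normD _ _))// [leRHS]mulrDl lerD//.
  apply: (le_trans (ler_norm_div ff Q0 Q1)).
  rewrite (_ : _ / _ = 16 ^+ 2 * H / k * (h / D))//; field.
  by rewrite !gt_eqF.
have fN : `|f * ((g - g1) * D ^+ 2 + g1 * (D ^+ 2 - D1 ^+ 2))| <=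
    H * D ^+ 4 * (h * D ^+ 3 * (17 + 16 * H * L ^+ 2)).
  by rewrite normrM ler_pM// ger0_norm.
have Q3 : 0 < k * D ^+ 4 by rewrite mulr_gt0// exprn_gt0.
have Q4 : k * D ^+ 4 / 16 * (k * D ^+ 4) <= g1 * D1 ^+ 2 * (g * D ^+ 2).
  exact: ler_pM (ltW Q0) (ltW Q3) Q1 Q2.
apply: (le_trans (ler_norm_div fN (mulr_gt0 Q0 Q3) Q4)).
rewrite (_ : _ / _ = 16 * H * (17 + 16 * H * L ^+ 2) / k ^+ 2 * (h / D))//; field.
by rewrite !gt_eqF.
Qed.

(** For almost antipodal pairs, which stay away from the singularity of the inverse square. The
    bound 192 h / D^3 and D >= L/3 give 192 * 9 = 12^3. *)
Lemma invf_sqr_sub_lip (R : realFieldType) (L D D1 D2 h : R) :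
  0 < L -> L / 3 <= D -> 0 <= h -> D / 2 <= D2 -> D2 <= D1 <= 3 / 2 * D ->
  D1 - D2 <= 4 * h ->
  `|(D1 ^+ 2)^-1 - (D2 ^+ 2)^-1| <= 12 ^+ 3 / L ^+ 2 * (h / D).
Proof.
move=> L0 LD h0 DD2 /andP[DD1 D1D] D12h.
have D0 : 0 < D by lra.
have D20 : 0 < D2 by lra.
have D10 : 0 < D1 by lra.
have -> : (D1 ^+ 2)^-1 - (D2 ^+ 2)^-1 = ((D2 - D1) * (D1 + D2)) / (D1 ^+ 2 * D2 ^+ 2).
  by field; rewrite !gt_eqF.
have P1 : `|(D2 - D1) * (D1 + D2)| <= 4 * h * (3 * D).
  rewrite normrM ler0_norm ?subr_le0// ger0_norm; last by lra.
  by rewrite ler_pM//; lra.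
apply: (le_trans (ler_norm_div P1 (_ : 0 < (D / 2) ^+ 2 * (D / 2) ^+ 2) _)).
- by rewrite !mulr_gt0// exprn_gt0// divr_gt0.
- by rewrite ler_pM ?sqr_ge0// lerXn2r ?nnegrE//; lra.
rewrite [leLHS](_ : _ = 192 / D ^+ 2 * (h / D)); last by field; rewrite gt_eqF.
rewrite ler_wpM2r ?divr_ge0// ?(ltW D0)//.
rewrite ler_pdivlMr ?exprn_gt0// mulrAC ler_pdivrMr ?exprn_gt0//.
by have : L ^+ 2 <= (3 * D) ^+ 2; [rewrite lerXn2r ?nnegrE; lra|lra].
Qed.

(** * The chord-arc inequality and the integrand on the circle *)

Section chord.
Variables (R : realType) (d : nat) (L : R) (gamma : R -> 'rV[R]_d) (H : R).
Hypothesis L0 : 0 < L.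
Hypothesis gamma_periodic : periodic gamma L.
Hypothesis dgamma : forall t, derivable gamma t 1.
Hypothesis gamma_simple : simple_closed L gamma.

Let phi := chord_defect gamma.
Hypothesis H0 : (0 : R) <= H.
Hypothesis phi_bounds : forall t s, 0 <= phi t s <= H * (t - s) ^+ 4.
Hypothesis phi_lip : forall t s t' s' (X : R),
  `|t - s| <= X -> `|t' - s| <= X -> `|t' - s'| <= X ->
  `|phi t' s' - phi t s| <= H * X ^+ 3 * (`|t' - t| + `|s' - s|).

Let g t s := enorm (gamma t - gamma s) ^+ 2.
Let gE t s : g t s = (t - s) ^+ 2 - phi t s.
Proof. by rewrite /phi /chord_defect /g; ring. Qed.

Let gC t s : g t s = g s t.
Proof. by rewrite !gE /phi chord_defectC; ring. Qed.

Let gamma_shift (m : int) t : gamma (t + L * m%:~R) = gamma t.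
Proof. exact: periodicz. Qed.

(** Injectivity is given on [0, L), so both points are reduced to it; equal images would make x a
    multiple of L. *)
Let far_chord (x u : R) : 0 < x < L -> 0 < g (u + x) u.
Proof.
move=> /andP[x0 xL]; rewrite lt_def sqr_ge0 andbT /g enorm_sqr.
apply/negP => /eqP g0; have gux : gamma (u + x) = gamma u.
  apply/rowP => i; apply/eqP; rewrite -subr_eq0 -sqrf_eq0.
  have := psumr_eq0P (fun i _ => sqr_ge0 _) g0 => /(_ i isT)/eqP.
  by rewrite !mxE.
have red t : exists2 m : int, Defs.arc L 0 t = t + L * m%:~R &
    gamma (Defs.arc L 0 t) = gamma t.
  pose k := Num.floor ((t - 0) / L).
  have E : Defs.arc L 0 t = t + L * (- k)%:~R.
    by rewrite /Defs.arc -/k rmorphN; ring.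
  by exists (- k) => //; rewrite E gamma_shift.
have [m mE gm] := red (u + x); have [k kE gk] := red u.
have := @gamma_simple (Defs.arc L 0 (u + x)) (Defs.arc L 0 u).
rewrite !in_itv/= !arc_bounds// => /(_ isT isT).
rewrite gm gk gux => /(_ erefl); rewrite mE kE => E.
have {}E : x = L * (k - m)%:~R by rewrite rmorphB/=; lra.
have := x0; have := xL; rewrite E -[ltRHS]mulr1 ltr_pM2l// pmulr_rgt0//.
by rewrite -[1]/(1%:~R) ltr_int ltr0z; lia.
Qed.

(** The positive continuous function (u, x) |-> g (u + x) u attains its minimum on a compact
    rectangle; periodicity brings every u into [0, L]. *)
Let compact_chord (delta : R) : 0 < delta <= L / 2 ->
  exists2 m, 0 < m & forall u x, delta <= x <= L - delta -> m <= g (u + x) u.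
Proof.
move=> /andP[delta0 deltaL].
pose A : set (R * R) := `[0, L] `*` `[delta, L - delta].
pose h (p : R * R) := g (p.1 + p.2) p.1.
have cA : compact A by apply: compact_setX; exact: segment_compact.
have A0 : A !=set0.
  by exists (0, delta); split; rewrite /= in_itv/=; apply/andP; split; lra.
have cg : continuous gamma.
  by move=> t; apply/differentiable_continuous/derivable1_diffP.
have ch : continuous h.
  have -> : h = fun p => \sum_(i < d) (gamma (p.1 + p.2) - gamma p.1) ord0 i ^+ 2.
    by apply/funext => p; rewrite /h/g enorm_sqr.
  have cgg : continuous (fun p : R * R => gamma (p.1 + p.2) - gamma p.1).
    move=> p; apply: cvgB; last first.
      by apply: (@continuous_comp _ _ _ fst gamma p); [exact: cvg_fst|exact: cg].
    apply: (@continuous_comp _ _ _ (fun q : R * R => q.1 + q.2) gamma p (add_continuous p)).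
    exact: cg.
  apply: continuous_big => [|i _ p]; first exact: add_continuous.
  apply: (@continuous_comp _ _ _ _ (fun M : 'rV[R]_d => M ord0 i ^+ 2) _ (cgg p)).
  apply: (@continuous_comp _ _ _ _ (fun y : R => y ^+ 2)).
    exact: coord_continuous.
  exact: exprn_continuous.
have [c] := compact_EVT_min A0 cA (continuous_subspaceT ch).
rewrite inE => -[]; rewrite /= !in_itv/= => /andP[? ?] /andP[? ?] hc.
exists (h c); first by apply: far_chord; apply/andP; split; lra.
move=> u x dx; pose k := Num.floor ((u - 0) / L).
have uE : Defs.arc L 0 u = u + L * (- k)%:~R.
  by rewrite /Defs.arc -/k rmorphN; ring.
have -> : g (u + x) u = h (Defs.arc L 0 u, x).
  by rewrite /h /= /g uE addrAC !gamma_shift.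
apply: hc; rewrite inE; split; rewrite /= in_itv//=.
by have /andP[-> /ltW] := arc_bounds L0 0 u.
Qed.

(** Up to distance [delta] the defect is at most half of the squared distance, since delta <= 1/(1 +
    2H) implies H delta^2 <= 1/2. Beyond [delta], the compactness minimum is compared with L^2. *)
Lemma chord_ge_circle_dist : exists2 k, 0 < k &
  forall t s, k * circle_dist L t s ^+ 2 <= enorm (gamma t - gamma s) ^+ 2.
Proof.
pose delta := Num.min (L / 2) (1 + 2 * H)^-1.
have H1 : 0 < 1 + 2 * H by rewrite ltr_pwDl// mulr_ge0.
have d0 : 0 < delta by rewrite /delta lt_min divr_gt0//= invr_gt0.
have dL : delta <= L / 2 by rewrite /delta ge_min lexx.
have dH : H * delta ^+ 2 <= 1 / 2.
  have : delta <= (1 + 2 * H)^-1 by rewrite /delta ge_min lexx orbT.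
  rewrite -[_^-1]mul1r ler_pdivlMr// => dH1; nra.
have [|m m0 hm] := @compact_chord delta; first by rewrite d0.
exists (Num.min (1 / 2) (m / L ^+ 2)).
  by rewrite lt_min divr_gt0//= divr_gt0// exprn_gt0.
move=> t s; have [k kE] := circle_dist_lift L0 t s.
have D2 := circle_dist_half L t s; have D0 := circle_dist_ge0 L0 t s.
set D := circle_dist L t s in kE D2 D0 *.
pose t' := t + L * k%:~R.
have {}kE : D = `|t' - s| by rewrite kE addrAC.
have -> : enorm (gamma t - gamma s) ^+ 2 = g t' s by rewrite /g gamma_shift.
have [Dd|dD] := leP D delta.
  rewrite gE; have /andP[_] := phi_bounds t' s.
  have DE : (t' - s) ^+ 2 = D ^+ 2 by rewrite kE real_normK ?num_real.
  rewrite (exprM _ 2 2) DE.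
  move=> phiD; have : Num.min (1 / 2) (m / L ^+ 2) * D ^+ 2 <= 1 / 2 * D ^+ 2.
    by rewrite ler_wpM2r ?sqr_ge0// ge_min lexx.
  have : D ^+ 2 <= delta ^+ 2 by rewrite lerXn2r ?nnegrE// ltW.
  have : H * D ^+ 2 * D ^+ 2 <= 1 / 2 * D ^+ 2.
    by rewrite ler_wpM2r ?sqr_ge0// (le_trans _ dH)// ler_wpM2l// lerXn2r ?nnegrE// ltW.
  by move: phiD; rewrite expr2 !mulrA; lra.
have mD : Num.min (1 / 2) (m / L ^+ 2) * D ^+ 2 <= m.
  rewrite (@le_trans _ _ (m / L ^+ 2 * L ^+ 2))//; last by rewrite divfK// lt0r_neq0// exprn_gt0.
  rewrite ler_pM ?sqr_ge0 ?lerXn2r ?nnegrE ?(ltW L0)//.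
  - by rewrite le_min !divr_ge0 ?sqr_ge0// ltW.
  - by rewrite ge_min lexx orbT.
  - lra.
apply: (le_trans mD); have [ts|ts] := leP s t'.
  by have := hm s (t' - s); rewrite subrKC; apply;
     rewrite ger0_norm ?subr_ge0// in kE; apply/andP; split; lra.
rewrite gC; have := hm t' (s - t'); rewrite subrKC; apply.
by rewrite ltr0_norm ?subr_lt0// in kE; apply/andP; split; lra.
Qed.


Definition mobius_integrand t s := (g t s)^-1 - (circle_dist L t s ^+ 2)^-1.

Variable k : R.
Hypothesis k0 : 0 < k.
Hypothesis k_chord : forall t s, k * circle_dist L t s ^+ 2 <= g t s.

Let lift t s : exists2 m : int, circle_dist L t s = `|t + L * m%:~R - s| &
  g t s = circle_dist L t s ^+ 2 - phi (t + L * m%:~R) s.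
Proof.
have [m mE] := circle_dist_lift L0 t s; exists m; first by rewrite mE addrAC.
by rewrite /g -(gamma_shift m t) -/(g _ s) gE mE real_normK ?num_real// addrAC.
Qed.

Lemma mobius_integrand_bounds t s : 0 <= mobius_integrand t s <= H / k.
Proof.
have [m mE gm] := lift t s; have := k_chord t s.
have := phi_bounds (t + L * m%:~R) s; rewrite /mobius_integrand.
rewrite (exprM _ 2 2) -(real_normK (num_real (_ + _ - s))) -[`|_|]mE -exprM gm.
by move=> ? ?; apply: invf_sub_bounds => //; exact: circle_dist_ge0.
Qed.

(** If D <= 4h, boundedness suffices because h/D >= 1/4; this gives the summand 4 H/k. Otherwise
    [A1] covers the displacement of the lifted pair and [A2] the case where the lift no longer
    realises the distance. *)
Lemma mobius_integrand_lip : exists2 A, 0 < A & forall h t s t' s' : R,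
  `|t' - t| <= h -> `|s' - s| <= h -> 0 < circle_dist L t s ->
  `|mobius_integrand t' s' - mobius_integrand t s| <= A * (h / circle_dist L t s).
Proof.
pose A1 := 16 ^+ 2 * H / k + 16 * H * (17 + 16 * H * L ^+ 2) / k ^+ 2.
have A10 : 0 <= A1.
  by rewrite addr_ge0// divr_ge0 ?mulr_ge0 ?addr_ge0 ?mulr_ge0 ?sqr_ge0// ltW.
pose A2 := 12 ^+ 3 / L ^+ 2.
have A20 : 0 < A2 by rewrite divr_gt0 ?exprn_gt0.
have Hk : 0 <= 4 * (H / k) by rewrite mulr_ge0// divr_ge0// ltW.
exists (4 * (H / k) + A1 + A2); first by rewrite ltr_wpDl// addr_ge0.
move=> h t s t' s' th sh; set D := circle_dist L t s => D0.
have h0 : 0 <= h by rewrite (le_trans _ th).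
have hD0 : 0 <= h / D by rewrite divr_ge0// ltW.
have [Dh|hD] := leP D (4 * h).
  have /andP[? ?] := mobius_integrand_bounds t s.
  have /andP[? ?] := mobius_integrand_bounds t' s'.
  have : `|mobius_integrand t' s' - mobius_integrand t s| <= H / k.
    by rewrite ler_norml; apply/andP; split; lra.
  move=> /le_trans; apply; rewrite (@le_trans _ _ (4 * (H / k) * (h / D)))//.
    rewrite mulrAC ler_peMl ?divr_ge0 ?(ltW k0)// mulrA ler_pdivlMr// mul1r.
    exact: Dh.
  by rewrite ler_wpM2r// -addrA lerDl addr_ge0// ltW.
have [m DE gm] := lift t s; rewrite -/D in DE gm.
set T := t + L * m%:~R in DE gm; pose T' := t' + L * m%:~R.
have TT : `|T' - T| <= h by rewrite /T' /T (_ : _ - _ = t' - t)//; ring.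
pose D1 := `|T' - s'|.
have DL : D <= L / 2 by exact: circle_dist_half.
have DD1 : `|D1 - D| <= 2 * h.
  rewrite DE /D1 (le_trans (ler_dist_dist _ _))//.
  rewrite (_ : _ - _ = (T' - T) - (s' - s)); last by ring.
  by rewrite (le_trans (ler_normB _ _))//; lra.
pose D2 := circle_dist L t' s'.
have D2D : D - 2 * h <= D2.
  have := circle_dist_lip L0 t' s' t s; rewrite -/D2 -/D (distrC t) (distrC s).
  lra.
have D2D1 : D2 <= D1.
  by rewrite /D1 /T' addrAC; exact: circle_dist_le.
have g1 : g t' s' = D1 ^+ 2 - phi T' s'.
  by rewrite /D1 real_normK ?num_real// -gE /g /T' gamma_shift.
have /andP[f10 _] := phi_bounds T' s'.
have ff : `|phi T' s' - phi T s| <= H * (2 * D) ^+ 3 * (2 * h).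
  have := @phi_lip T s T' s' (2 * D).
  rewrite -DE -/D1; move: DD1; rewrite ler_norml => /andP[? ?].
  move=> /(_ _ _ _)/le_trans; apply.
  - lra.
  - rewrite (_ : T' - s = (T' - T) + (T - s)); last by ring.
    by rewrite (le_trans (ler_normD _ _))// -DE; lra.
  - lra.
  - rewrite ler_wpM2l ?mulr_ge0 ?exprn_ge0 ?mulr_ge0 ?(ltW D0)//; lra.
have e1 := @invf_sub_lip R L H k D D1 (phi T s) (phi T' s') h.
have {}e1 : `|((D1 ^+ 2 - phi T' s')^-1 - (D1 ^+ 2)^-1) -
    ((D ^+ 2 - phi T s)^-1 - (D ^+ 2)^-1)| <= A1 * (h / D).
  apply: e1 => //.
  - by rewrite D0 /=; lra.
  - exact: ltW.
  - have /andP[-> /=] := phi_bounds T s.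
    by rewrite (exprM _ 2 2) -(real_normK (num_real (T - s))) -[`|_|]DE -exprM.
  - by rewrite -gm; exact: k_chord.
  - rewrite -g1 (le_trans _ (k_chord t' s'))// ler_wpM2l ?(ltW k0)//.
    by rewrite lerXn2r ?nnegrE ?circle_dist_ge0// -/D2; lra.
(* The lift of the displaced points realises their distance unless they have
   become almost antipodal. *)
have e2 : `|(D1 ^+ 2)^-1 - (D2 ^+ 2)^-1| <= A2 * (h / D).
  have [D1L|LD1] := leP D1 (L / 2).
    have -> : D2 = D1.
      by rewrite /D2 -(circle_dist_shift L0 m 0) mulr0 addr0; exact: circle_dist_near.
    by rewrite subrr normr0 mulr_ge0// ltW.
  move: DD1; rewrite ler_norml => /andP[? ?].
  (* From D1 > L/2 and D1 <= D + 2h <= 3/2 D one gets D >= L/3; D2 >= D - 2h gives D1 - D2 <= 4h. *)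
  by apply: invf_sqr_sub_lip => //; try (apply/andP; split); lra.
rewrite /mobius_integrand g1 gm -/D -/D2.
rewrite (_ : _ - _ - _ = (((D1 ^+ 2 - phi T' s')^-1 - (D1 ^+ 2)^-1) -
    ((D ^+ 2 - phi T s)^-1 - (D ^+ 2)^-1)) + ((D1 ^+ 2)^-1 - (D2 ^+ 2)^-1)); last by ring.
rewrite (le_trans (ler_normD _ _))// (le_trans (lerD e1 e2))// -mulrDl.
by rewrite ler_wpM2r// -[leRHS]addrA lerDr.
Qed.

Lemma mobius_integrandC t s : mobius_integrand t s = mobius_integrand s t.
Proof. by rewrite /mobius_integrand gC (circle_distC L0). Qed.

Lemma mobius_integrand_shift (j m : int) t s :
  mobius_integrand (t + L * j%:~R) (s + L * m%:~R) = mobius_integrand t s.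
Proof. by rewrite /mobius_integrand /g !gamma_shift (circle_dist_shift L0). Qed.

End chord.

(** * Subdivisions and inscribed polygons *)

(* The increment of [u] from [k] to its cyclic successor, when [u] is continued
   to all integers by [u (k + n) = u k + U]. It is linear in [(U, u)], so that a
   comparison of two sequences reduces to the sign of increments. *)
Definition cyclic_step (R : realType) (U : R) (n : nat) (u : 'I_n -> R) (k : 'I_n) : R :=
  u (ordS k) - u k + U *+ (k.+1 == n).

(** The upper bound passes through the wrap-around increment: u j <= u last <= u first + U <= u i +
    U. *)
Lemma cyclic_step_ge0_mono (R : realType) (U : R) (n : nat) (u : 'I_n -> R) :
  (forall k, 0 <= cyclic_step U u k) ->
  forall i j : 'I_n, (i <= j)%N -> u i <= u j <= u i + U.
Proof.
move=> u_ge0 i j ij.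
have mono (p q : 'I_n) : (p <= q)%N -> u p <= u q.
  have [m] := ubnP (q - p)%N; elim: m p => // m ih p qpm pq.
  have [/val_inj -> //|pNq] := eqVneq (p : nat) q.
  have pq' : (p < q)%N by rewrite ltn_neqAle pNq.
  have vS : ordS p = p.+1 :> nat by rewrite /= modn_small// (leq_ltn_trans pq').
  have := u_ge0 p; rewrite /cyclic_step ltn_eqF ?(leq_ltn_trans pq')// addr0 subr_ge0.
  by move=> /le_trans; apply; apply: ih; rewrite vS//; lia.
have n0 : (0 < n)%N by apply: leq_ltn_trans (ltn_ord i).
pose first := Ordinal n0.
have lastP : (n.-1 < n)%N by rewrite prednK.
pose last := Ordinal lastP.
have lastS : ordS last = first by apply: val_inj; rewrite /= prednK// modnn.
have := u_ge0 last; rewrite /cyclic_step lastS /= prednK// eqxx mulr1n => h.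
have h1 := mono first i (leq0n _).
have h2 : u j <= u last by apply: mono; rewrite /= -ltnS prednK.
by rewrite mono//=; lra.
Qed.

Lemma subdivision_circle_dist (R : realType) (L : R) (n : nat) (b : 'I_n -> R)
    (i j : 'I_n) : 0 < L ->
  subdivision L b -> (i < j)%N ->
  circle_dist L (b i) (b j) = Num.min (b j - b i) (L - (b j - b i)).
Proof.
move=> L0 [b_mono b_per] ij; rewrite /circle_dist.
suff -> : Defs.arc L (b i) (b j) = b j - b i by [].
rewrite (@arc_unique _ _ L0 0) mulr0 addr0// subr_ge0 ltW ?b_mono//=.
by rewrite ltrBlDl.
Qed.

Lemma subdivision_arc_step (R : realType) (L : R) (n : nat) (b : 'I_n -> R)
    (k : 'I_n) : 0 < L -> (1 < n)%N -> subdivision L b ->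
  [/\ Defs.arc L (b k) (b (ordS k)) = cyclic_step L b k,
      0 < cyclic_step L b k &
      exists m : int, b k + cyclic_step L b k = b (ordS k) + L * m%:~R].
Proof.
move=> L0 n1 [b_mono b_per]; rewrite /cyclic_step.
have [kn|kn] := eqVneq k.+1 n.
  have S0 : (ordS k < k)%N by rewrite /= kn modnn; lia.
  have b1 := b_mono _ _ S0; have b2 := b_per (ordS k) k.
  rewrite mulr1n; split; [|lra|by exists 1; rewrite mulr1; ring].
  by rewrite (@arc_unique _ _ L0 1) mulr1//; apply/andP; split; lra.
have kS : (k < ordS k)%N.
  by rewrite /= modn_small// ltn_neqAle kn/=.
have b1 := b_mono _ _ kS; have b2 := b_per k (ordS k).
rewrite mulr0n addr0; split; [|lra|by exists 0; rewrite mulr0; ring].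
by rewrite (@arc_unique _ _ L0 0) mulr0 addr0//; apply/andP; split; lra.
Qed.

(** The straight edge is evaluated at the end of its arc, which agrees with [a (ordS k)] up to a
    multiple of the period. *)
Lemma polygon_edge (R : realType) (d : nat) (l : R) (n : nat) (p : R -> 'rV[R]_d)
    (a : 'I_n -> R) (k : 'I_n) : (1 < n)%N -> closed_polygon l p a ->
  enorm (p (a (ordS k)) - p (a k)) = cyclic_step l a k.
Proof.
move=> n1 [p_per a_sub p_edge].
have l0 : 0 < l by have [_ /(_ k k)] := a_sub; rewrite ltrDl.
have [aE a0 [m mE]] := subdivision_arc_step k l0 n1 a_sub.
have [u u1 /(_ (cyclic_step l a k))] := p_edge k.
rewrite aE lexx (ltW a0) => /(_ isT); rewrite mE periodicz// => ->.
by rewrite addrAC subrr add0r enormZ ?ltW// u1 mulr1.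
Qed.

(** The sign of [x] is free because the factor [1 - eta] used below can be negative for small n. *)
Lemma ler_pM_min (R : realDomainType) (x u v u' v' : R) :
  0 <= u -> 0 <= v -> 0 <= u' -> 0 <= v' -> x * u <= u' -> x * v <= v' ->
  x * Num.min u v <= Num.min u' v'.
Proof.
move=> u0 v0 u'0 v'0 xu xv; have [x0|x0] := leP 0 x.
  by rewrite le_min; apply/andP; split; [apply: le_trans xu|apply: le_trans xv];
     rewrite ler_wpM2l// ge_min lexx ?orbT.
rewrite (@le_trans _ _ 0)//; last by rewrite le_min u'0.
by rewrite mulr_le0_ge0 ?(ltW x0)// le_min u0.
Qed.

(** * Comparison of the inscribed polygon with the curve *)

Section polygon.
Variables (R : realType) (d : nat) (L : R) (gamma : R -> 'rV[R]_d).
Variables (H kappa c cbar : R).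
Hypothesis L0 : 0 < L.
Hypothesis gamma_periodic : periodic gamma L.
Hypothesis H0 : (0 : R) <= H.
Hypothesis phi_bounds :
  forall t s, 0 <= chord_defect gamma t s <= H * (t - s) ^+ 4.
Hypothesis kappa0 : (0 : R) < kappa.
Hypothesis kappa_chord :
  forall t s, kappa * circle_dist L t s <= enorm (gamma t - gamma s).
Hypothesis c0 : (0 : R) < c.
Hypothesis cbar0 : (0 : R) < cbar.

Let g t s := enorm (gamma t - gamma s) ^+ 2.
(** The common bound for the arcs is [C1 / n]: the part [cbar / kappa] serves arcs up to half of the
    circle, the part with [2 * L / c] the longer ones. *)
Let C1 := cbar / kappa * (1 + 2 * L / c).
Let C10 : 0 < C1.
Proof.
by rewrite mulr_gt0 ?divr_gt0// ltr_wpDr// divr_ge0 ?mulr_ge0// ltW.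
Qed.

Variables (n : nat) (b : 'I_n -> R) (p : R -> 'rV[R]_d) (a : 'I_n -> R).
Hypothesis n0 : (0 < n)%N.
Hypothesis b_sub : subdivision L b.
Hypothesis edge_bounds : forall k : 'I_n,
  c / n%:R <= enorm (gamma (b (ordS k)) - gamma (b k)) <= cbar / n%:R.
Hypothesis pP : inscribed_polygon gamma b p a.

Let l := inscribed_length gamma b.
Let edge k := enorm (gamma (b (ordS k)) - gamma (b k)).
Let Del := cyclic_step L b.

Lemma polygon_size_gt1 : (1 < n)%N.
Proof.
rewrite ltn_neqAle n0 andbT; apply/negP => /eqP n1.
pose k := Ordinal n0; have kk : ordS k = k.
  by apply: val_inj; rewrite /= -n1 modn1.
have /andP[+ _] := edge_bounds k; rewrite kk subrr -(scale0r (0 : 'rV[R]_d)).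
by rewrite enormZ// mul0r leNgt divr_gt0// ltr0n.
Qed.

Let n1 := polygon_size_gt1.
Let nR : (0 : R) < n%:R. Proof. by rewrite ltr0n. Qed.
Let n1R : 2 <= n%:R :> R. Proof. by rewrite ler_nat. Qed.
Let cn0 : 0 < c / n%:R. Proof. by rewrite divr_gt0. Qed.

Lemma polygon_edgeE k : edge k = cyclic_step l a k.
Proof. by have [pa pb] := pP; rewrite -(polygon_edge k n1 pa) !pb. Qed.

Let Del_gt0 k : 0 < Del k.
Proof. by have [] := subdivision_arc_step k L0 n1 b_sub. Qed.

Let edge_gt0 k : 0 < edge k.
Proof. by have /andP[h _] := edge_bounds k; apply: lt_le_trans h. Qed.

(** The defect bound gives Del^2 - edge^2 <= H Del^4, and the left side is at least (Del - edge)
    Del. It is applied on the line, where the two parameters differ by Del however long the arc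
    is. *)
Lemma polygon_edge_le_arc k : edge k <= Del k <= edge k + H * Del k ^+ 3.
Proof.
have D0 := Del_gt0 k; have e0 := edge_gt0 k.
have [_ _ [m mE]] := subdivision_arc_step k L0 n1 b_sub.
have := phi_bounds (b k + Del k) (b k).
have -> : b k + Del k - b k = Del k by ring.
rewrite /chord_defect; have -> : b k + Del k - b k = Del k by ring.
have -> : gamma (b k + Del k) = gamma (b (ordS k)) by rewrite [X in gamma X]mE periodicz.
rewrite -/(edge k) =>  /andP[h1 h2]; have eD : edge k <= Del k.
  by rewrite -ler_sqr ?nnegrE ?(ltW D0) ?(ltW e0)//; lra.
rewrite eD/= -lerBlDl -(ler_pM2l D0).
rewrite (_ : Del k * (H * Del k ^+ 3) = H * Del k ^+ 4); last by ring.
by apply: le_trans h2; nra.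
Qed.

(** The points are compared with an arithmetic progression of step c/n: each arc is at least its
    edge, so the difference has nonnegative increments, with total L - c. *)
Lemma subdivision_spread (i j : 'I_n) : (i <= j)%N ->
  c / n%:R * (j%:R - i%:R) <= b j - b i /\
  c / n%:R * (n%:R - (j%:R - i%:R)) <= L - (b j - b i).
Proof.
move=> ij; pose u (k : 'I_n) := b k - c / n%:R * k%:R.
have u0 k : 0 <= cyclic_step (L - c) u k.
  suff -> : cyclic_step (L - c) u k = Del k - c / n%:R.
    have /andP[h _] := edge_bounds k; have /andP[h' _] := polygon_edge_le_arc k.
    by rewrite subr_ge0 (le_trans h).
  rewrite /Del /cyclic_step /u; have [kn|kn] := eqVneq k.+1 n.
    have : c = c / n%:R * (k%:R + 1) by rewrite natr1 kn divfK ?gt_eqF.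
    by rewrite !mulr1n /= kn modnn; lra.
  have -> : ordS k = k.+1 :> nat by rewrite /= modn_small// ltn_neqAle kn/=.
  by rewrite !mulr0n -natr1; ring.
have /andP[] := cyclic_step_ge0_mono u0 ij; rewrite /u => h1 h2.
have : c / n%:R * n%:R = c by rewrite divfK ?gt_eqF.
move: h1 h2; set z := c / n%:R; nra.
Qed.

(* When the arc is longer than half of the circle, the other points share the
   complementary arc, which forces [n] to be bounded. *)
Lemma arc_le k : Del k <= C1 / n%:R.
Proof.
have D0 := Del_gt0 k.
have [arcE _ _] := subdivision_arc_step k L0 n1 b_sub.
have /andP[_ eU] := edge_bounds k; rewrite -/(edge k) in eU.
have := kappa_chord (b (ordS k)) (b k).
rewrite (circle_distC L0) /circle_dist arcE -/(edge k) -/(Del k) => kU.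
(* The complement consists of the n - 1 other arcs, each at least c/n, and (n - 1)/n >= 1/2. *)
have LD : c / 2 <= L - Del k.
  rewrite /Del /cyclic_step; have [kn|kn] := eqVneq k.+1 n.
    have [+ _] := @subdivision_spread (ordS k) k (ltac:(by rewrite /= kn modnn)).
    rewrite mulr1n /= kn modnn subr0 => h; apply: (@le_trans _ _ (c / n%:R * k%:R)).
      rewrite mulrAC ler_pdivlMr//; have : 1 <= k%:R :> R by rewrite ler1n -ltnS kn.
      have -> : n%:R = k%:R + 1 :> R by rewrite natr1 kn.
      move=> k1; have : 0 <= c * (k%:R - 1) by rewrite mulr_ge0 ?subr_ge0// ltW.
      lra.
    lra.
  have vS : ordS k = k.+1 :> nat by rewrite /= modn_small// ltn_neqAle kn/=.
  have [_] := @subdivision_spread k (ordS k) (ltac:(by rewrite vS)).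
  rewrite vS mulr0n addr0 -natr1 => h; apply: (@le_trans _ _ (c / n%:R * (n%:R - 1))).
    rewrite mulrAC ler_pdivlMr//.
    have : 0 <= c * (n%:R - 2) by rewrite mulr_ge0 ?subr_ge0// ltW.
    lra.
  by move: h; rewrite (_ : k%:R + 1 - k%:R = 1 :> R)//; ring.
have k1 : cbar / kappa / n%:R <= C1 / n%:R.
  by rewrite ler_pM2r ?invr_gt0// /C1 ler_peMr ?lerDl ?divr_ge0 ?mulr_ge0//
    ?(ltW cbar0) ?(ltW kappa0) ?(ltW L0) ?(ltW c0).
have [h|h] := leP (Del k) (L - Del k).
  apply: le_trans k1; rewrite -[leRHS]mulrA (mulrC kappa^-1) mulrA ler_pdivlMr//.
  by apply: le_trans eU; move: kU; rewrite min_l// mulrC.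
have {}kU : kappa * (c / 2) <= cbar / n%:R.
  apply: le_trans eU; apply: le_trans kU; rewrite min_r ?(ltW h)//.
  by rewrite ler_pM2l.
rewrite (@le_trans _ _ (2 * L / c * (cbar / kappa) / n%:R))//; last first.
  rewrite ler_pM2r ?invr_gt0// /C1 mulrC ler_pM2l ?divr_gt0//; lra.
have -> : 2 * L / c * (cbar / kappa) / n%:R = L * ((cbar / n%:R) / (kappa * (c / 2))).
  by field; rewrite !gt_eqF.
have c20 : 0 < c / 2 by rewrite divr_gt0.
apply: (@le_trans _ _ L); first by lra.
by rewrite ler_peMr ?(ltW L0)// ler_pdivlMr ?mul1r// mulr_gt0// divr_gt0.
Qed.


(** Bounds the relative shortening H Del^2 from an arc to its chord. *)
Let eta := H * (C1 / n%:R) ^+ 2.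

Let edge_ge_step k : (1 - eta) * Del k <= edge k.
Proof.
have D0 := Del_gt0 k; have /andP[_ h] := polygon_edge_le_arc k.
have : H * Del k ^+ 3 <= eta * Del k.
  rewrite (_ : H * Del k ^+ 3 = H * Del k ^+ 2 * Del k); last by ring.
  rewrite ler_pM2r// ler_wpM2l// lerXn2r ?nnegrE ?divr_ge0 ?(ltW D0) ?(ltW C10) ?(ltW nR)//.
  exact: arc_le.
lra.
Qed.

(** A cruder ratio than [1 - eta], but positive for every n, as the denominators require. *)
Let edge_ge_ratio k : c / C1 * Del k <= edge k.
Proof.
have /andP[h _] := edge_bounds k; apply: le_trans h.
by rewrite mulrAC ler_pdivrMr// -mulrA ler_pM2l// mulrC; exact: arc_le.
Qed.

(** The combination y v - x u has nonnegative increments. Both an arc and its complement are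
    compared, hence also their minimum, the intrinsic distance. *)
Let cyclic_compare (U V x y : R) (u v : 'I_n -> R) (i j : 'I_n) : (i <= j)%N ->
  (forall k, x * cyclic_step U u k <= y * cyclic_step V v k) ->
  x * (u j - u i) <= y * (v j - v i) /\
  x * (U - (u j - u i)) <= y * (V - (v j - v i)).
Proof.
move=> ij uv; pose w k := y * v k - x * u k.
have w0 k : 0 <= cyclic_step (y * V - x * U) w k.
  suff -> : cyclic_step (y * V - x * U) w k =
      y * cyclic_step V v k - x * cyclic_step U u k by rewrite subr_ge0.
  by rewrite /cyclic_step /w; case: eqP => _; rewrite ?mulr1n ?mulr0n; ring.
by have /andP[] := cyclic_step_ge0_mono w0 ij; rewrite /w; split; lra.
Qed.

Lemma polygon_dist_compare i j : i != j ->
  [/\ c / C1 * circle_dist L (b i) (b j) <= circle_dist l (a i) (a j),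
      circle_dist l (a i) (a j) <= circle_dist L (b i) (b j) &
      (1 - eta) * circle_dist L (b i) (b j) <= circle_dist l (a i) (a j)].
Proof.
have a_sub : subdivision l a by have [[]] := pP.
have l0 : 0 < l by have [_ /(_ i i)] := a_sub; rewrite ltrDl.
wlog ij : i j / (i < j)%N.
  move=> wl; rewrite neq_ltn => /orP[ij|ij]; first by apply: wl; rewrite ?neq_ltn ?ij.
  by rewrite (circle_distC L0) (circle_distC l0); apply: wl; rewrite ?neq_ltn ?ij.
move=> _; rewrite !subdivision_circle_dist//.
have [le1 le1'] : 1 * (a j - a i) <= 1 * (b j - b i) /\
    1 * (l - (a j - a i)) <= 1 * (L - (b j - b i)).
  apply: cyclic_compare => [|k]; first exact: ltnW.
  by rewrite -polygon_edgeE !mul1r; have /andP[] := polygon_edge_le_arc k.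
have [le2 le2'] : c / C1 * (b j - b i) <= 1 * (a j - a i) /\
    c / C1 * (L - (b j - b i)) <= 1 * (l - (a j - a i)).
  apply: cyclic_compare => [|k]; first exact: ltnW.
  by rewrite -polygon_edgeE mul1r; exact: edge_ge_ratio.
have [le3 le3'] : (1 - eta) * (b j - b i) <= 1 * (a j - a i) /\
    (1 - eta) * (L - (b j - b i)) <= 1 * (l - (a j - a i)).
  apply: cyclic_compare => [|k]; first exact: ltnW.
  by rewrite -polygon_edgeE mul1r; exact: edge_ge_step.
rewrite !mul1r in le1 le1' le2 le2' le3 le3'.
have [bm bp] := b_sub; have [am ap] := a_sub.
have bij := bm _ _ ij; have bji := bp i j; have aij := am _ _ ij; have aji := ap i j.
have cC : 0 < c / C1 by rewrite divr_gt0.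
split; try (by apply: ler_pM_min => //; lra).
by rewrite -[leLHS]mul1r; apply: ler_pM_min; lra.
Qed.


(** The first summand comes from [eta], the second from arcs longer than half of the circle. *)
Let E0 := H * C1 ^+ 2 + (2 * C1 / L) ^+ 2.
Let q k := circle_dist l (a (ordS k)) (a k).

Let q_le_step k : 0 <= q k <= Del k /\ Del k - q k <= E0 / n%:R ^+ 2 * Del k.
Proof.
have D0 := Del_gt0 k.
have a_sub : subdivision l a by have [[]] := pP.
have l0 : 0 < l by have [_ /(_ k k)] := a_sub; rewrite ltrDl.
have kS : k != ordS k.
  apply/eqP => /(congr1 val) /=; have [kn|kn] := eqVneq k.+1 n.
    by rewrite kn modnn => k0; have := n1; rewrite -[X in (1 < X)%N]kn k0.

  have kn' : (k.+1 < n)%N by rewrite ltn_neqAle kn ltn_ord.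
  by rewrite modn_small// => /eqP; rewrite ltn_eqF.
have [_ qD Dq] := polygon_dist_compare kS.
have [arcE _ _] := subdivision_arc_step k L0 n1 b_sub.
have DE : circle_dist L (b k) (b (ordS k)) = Num.min (Del k) (L - Del k).
  by rewrite /circle_dist arcE.
rewrite (circle_distC l0) -/(q k) DE in qD Dq.
have q0 : 0 <= q k by exact: circle_dist_ge0.
have qDel : q k <= Del k by apply: (le_trans qD); rewrite ge_min lexx.
rewrite q0 qDel; split=> //.
have etaE : eta <= E0 / n%:R ^+ 2.
  by rewrite /eta /E0 expr_div_n mulrA ler_pM2r ?invr_gt0 ?exprn_gt0// lerDl sqr_ge0.
have [DL|LD] := leP (Del k) (L - Del k).
  rewrite min_l// in Dq.
  by apply: (@le_trans _ _ (eta * Del k)); [lra|rewrite ler_pM2r].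
(* Here Del > L/2 and Del <= C1/n, so 1 <= (2 C1/(L n))^2 and the trivial bound Del - q <= Del
   already has the required form. *)
apply: (@le_trans _ _ (Del k)); first by rewrite gerBl.
have : Del k <= C1 / n%:R by exact: arc_le.
have -> : E0 / n%:R ^+ 2 = eta + (2 / L * (C1 / n%:R)) ^+ 2.
  by rewrite /E0 /eta; field; rewrite !gt_eqF.
move=> DC; rewrite ler_peMl ?(ltW D0)//.
have : 1 <= 2 / L * (C1 / n%:R) by rewrite mulrAC ler_pdivlMr//; lra.
move=> x1; have : 1 <= (2 / L * (C1 / n%:R)) ^+ 2 by rewrite exprn_ege1.
have : 0 <= eta by rewrite mulr_ge0// sqr_ge0.
lra.
Qed.


Lemma polygon_dist_lower (i j : 'I_n) : (i < j)%N ->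
  c / n%:R * Num.min (j - i)%:R (n - (j - i))%:R <= circle_dist L (b i) (b j).
Proof.
move=> ij; have [h1 h2] := subdivision_spread (ltnW ij).
rewrite subdivision_circle_dist// !natrB ?(ltnW ij)//; last first.
  by rewrite (leq_trans (leq_subr _ _))// ltnW.
have ji : (i%:R : R) <= j%:R by rewrite ler_nat ltnW.
have jn : (j%:R : R) <= n%:R by rewrite ler_nat ltnW.
have i0 : (0 : R) <= i%:R by [].
have [bm bp] := b_sub; have bij := bm _ _ ij; have bji := bp i j.
by apply: ler_pM_min => //; lra.
Qed.

Lemma polygon_dist_min i j : i != j -> c / n%:R <= circle_dist L (b i) (b j).
Proof.
wlog ij : i j / (i < j)%N.
  move=> wl; rewrite neq_ltn => /orP[ij|ij]; first by apply: wl; rewrite ?neq_ltn ?ij.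
  by rewrite (circle_distC L0); apply: wl; rewrite ?neq_ltn ?ij.
move=> _; apply: le_trans (polygon_dist_lower ij); rewrite ler_peMr ?(ltW cn0)//.
by rewrite le_min !ler1n !subn_gt0 ij (leq_ltn_trans (leq_subr _ _)).
Qed.

(** Vertices lie on the curve, so the chord terms agree and only weights and intrinsic distances
    change. The weights cost O(n^-4), put in the common form by D <= L; the distances cost O(n^-4 /
    D^2), reduced by c/n <= D. *)
Lemma polygon_term_error (M : R) i j : 0 <= M -> i != j ->
  0 <= (g (b j) (b i))^-1 - (circle_dist L (b j) (b i) ^+ 2)^-1 <= M ->
  `|((enorm (p (a j) - p (a i)) ^+ 2)^-1 - (circle_dist l (a j) (a i) ^+ 2)^-1)
      * circle_dist l (a (ordS i)) (a i) * circle_dist l (a (ordS j)) (a j)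
    - ((g (b j) (b i))^-1 - (circle_dist L (b j) (b i) ^+ 2)^-1) * Del i * Del j| <=
  (2 * M * E0 * C1 ^+ 2 * L + 2 * H * C1 ^+ 6 / c ^+ 3) /
    (n%:R ^+ 3 * circle_dist L (b j) (b i)).
Proof.
move=> M0 ij; have ji : j != i by rewrite eq_sym.
have [_ pb] := pP; rewrite !pb -/(g _ _).
have [r1 r2 r3] := polygon_dist_compare ji; have r4 := polygon_dist_min ji.
have DL := circle_dist_half L (b j) (b i).
have [/andP[qi0 qi1] qi2] := q_le_step i; have [/andP[qj0 qj1] qj2] := q_le_step j.
have di := arc_le i; have dj := arc_le j.
rewrite -/(q i) -/(q j) -/(Del i) -/(Del j) in di dj *.
move: r1 r2 r3 r4 DL; set D := circle_dist L _ _; set D' := circle_dist l _ _.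
set G := (g _ _)^-1 => r1 r2 r3 r4 DL /andP[F0 FM].
have D0 : 0 < D by exact: lt_le_trans r4.
have rho0 : 0 < c / C1 by rewrite divr_gt0.
have D'0 : 0 < D' by apply: lt_le_trans r1; rewrite mulr_gt0.
have E00 : 0 <= E0 by rewrite addr_ge0 ?sqr_ge0// mulr_ge0 ?sqr_ge0.
have dd0 : 0 < C1 / n%:R by rewrite divr_gt0.
have Di0 := Del_gt0 i; have Dj0 := Del_gt0 j.
have DD : Del i * Del j <= (C1 / n%:R) ^+ 2.
  by rewrite expr2 ler_pM// ltW.
have qqD : `|q i * q j - Del i * Del j| <= 2 * (E0 / n%:R ^+ 2) * (C1 / n%:R) ^+ 2.
  have x0 : 0 <= E0 / n%:R ^+ 2 by rewrite divr_ge0// sqr_ge0.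
  apply: (@le_trans _ _ (2 * (E0 / n%:R ^+ 2) * (Del i * Del j))); last first.
    by rewrite ler_wpM2l// mulr_ge0.
  rewrite distrC ger0_norm ?subr_ge0 ?ler_pM//.
  have -> : Del i * Del j - q i * q j = Del i * (Del j - q j) + q j * (Del i - q i) by ring.
  have e1 : Del i * (Del j - q j) <= Del i * (E0 / n%:R ^+ 2 * Del j) by rewrite ler_pM2l.
  have e2 : q j * (Del i - q i) <= Del j * (E0 / n%:R ^+ 2 * Del i).
    by rewrite ler_pM ?subr_ge0.
  lra.
have invD : `|(D ^+ 2)^-1 - (D' ^+ 2)^-1| <= 2 * eta / ((c / C1) ^+ 2 * D ^+ 2).
  have -> : (D ^+ 2)^-1 - (D' ^+ 2)^-1 = ((D' - D) * (D' + D)) / (D' ^+ 2 * D ^+ 2).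
    by field; rewrite !gt_eqF.
  have num : `|(D' - D) * (D' + D)| <= eta * D * (2 * D).
    rewrite normrM ler0_norm ?subr_le0// ger0_norm ?addr_ge0 ?(ltW D0) ?(ltW D'0)//.
    by rewrite ler_pM ?addr_ge0 ?(ltW D0) ?(ltW D'0)//; lra.
  have D20 : 0 < D ^+ 2 by rewrite exprn_gt0.
  have den0 : 0 < (c / C1 * D) ^+ 2 * D ^+ 2.
    exact: mulr_gt0 (exprn_gt0 2 (mulr_gt0 rho0 D0)) D20.
  have den : (c / C1 * D) ^+ 2 * D ^+ 2 <= D' ^+ 2 * D ^+ 2.
    rewrite ler_pM2r// lerXn2r ?nnegrE ?(ltW D'0)//.
    by rewrite mulr_ge0 ?(ltW D0) ?(ltW rho0).
  apply: (le_trans (ler_norm_div num den0 den)).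
  rewrite [leLHS](_ : _ = 2 * eta / ((c / C1) ^+ 2 * D ^+ 2))//.
  by field; rewrite !gt_eqF.
have -> : (G - (D' ^+ 2)^-1) * q i * q j - (G - (D ^+ 2)^-1) * Del i * Del j =
  (G - (D ^+ 2)^-1) * (q i * q j - Del i * Del j) +
  ((D ^+ 2)^-1 - (D' ^+ 2)^-1) * (q i * q j) by ring.
rewrite (le_trans (ler_normD _ _))// [leRHS]mulrDl lerD//.
  rewrite normrM ger0_norm//.
  apply: (@le_trans _ _ (M * (2 * (E0 / n%:R ^+ 2) * (C1 / n%:R) ^+ 2))).
    by rewrite ler_pM.
  have -> : M * (2 * (E0 / n%:R ^+ 2) * (C1 / n%:R) ^+ 2) =
      2 * M * E0 * C1 ^+ 2 * D / n%:R / (n%:R ^+ 3 * D).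
    by field; rewrite !gt_eqF.
  rewrite ler_pM2r ?invr_gt0 ?mulr_gt0 ?exprn_gt0// -mulrA.
  have P0 : 0 <= 2 * M * E0 * C1 ^+ 2.
    exact: mulr_ge0 (mulr_ge0 (mulr_ge0 (ler0n _ 2) M0) E00) (sqr_ge0 _).
  rewrite (ler_wpM2l P0)// ler_pdivrMr//.
  by apply: (@le_trans _ _ L); [lra|rewrite ler_peMr ?(ltW L0)// ler1n].
have qq : q i * q j <= (C1 / n%:R) ^+ 2 by rewrite (le_trans _ DD)// ler_pM.
rewrite normrM [X in _ * X]ger0_norm ?mulr_ge0//.
apply: (@le_trans _ _ (2 * eta / ((c / C1) ^+ 2 * D ^+ 2) * (C1 / n%:R) ^+ 2)).
  by rewrite ler_pM ?mulr_ge0.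
have -> : 2 * eta / ((c / C1) ^+ 2 * D ^+ 2) * (C1 / n%:R) ^+ 2 =
    2 * H * C1 ^+ 6 / c ^+ 3 * ((c / n%:R) / D) / (n%:R ^+ 3 * D).
  by rewrite /eta; field; rewrite !gt_eqF.
rewrite ler_pM2r ?invr_gt0 ?mulr_gt0 ?exprn_gt0//.
rewrite ler_piMr//; last by rewrite ler_pdivrMr// mul1r.
exact: divr_ge0 (mulr_ge0 (mulr_ge0 (ler0n _ 2) H0) (exprn_ge0 6 (ltW C10))) (exprn_ge0 3 (ltW c0)).
Qed.

End polygon.

(** * Step functions and arcs *)

(* Unlike [ge0_le_integral], no measurability is required: for a nonnegative
   function the integral is by definition the supremum of the integrals of the
   simple functions below it. *)
Lemma le_integral_nomeas (d : measure_display) (T : measurableType d) (R : realType)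
    (mu : {measure set T -> \bar R}) (D : set T) (f1 f2 : T -> \bar R) :
  (forall x, D x -> 0 <= f1 x)%E -> (forall x, D x -> f1 x <= f2 x)%E ->
  (\int[mu]_(x in D) f1 x <= \int[mu]_(x in D) f2 x)%E.
Proof.
move=> f10 f12; have f20 x : D x -> (0 <= f2 x)%E.
  by move=> Dx; rewrite (le_trans (f10 x Dx))// f12.
rewrite !ge0_integralE//; apply: ereal_sup_le => _ [h hf1 <-]; exists h => //= x.
exact: le_trans (hf1 x) (lee_restrict f12 x).
Qed.

Section step_functions.
Variables (R : realType) (D : set R) (n : nat).
Hypothesis mD : measurable D.

Let mu := @lebesgue_measure R.

(** Grouped by the cell of [s]: for fixed [t] it is a combination of indicators, so one formula in a
    single variable integrates it twice. *)
Definition step_fun (A : 'I_n -> set R) (w : 'I_n -> 'I_n -> R) (t s : R) : R :=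
  \sum_(j < n) (\sum_(i < n) w i j * \1_(A i) t) * \1_(A j) s.

Let integral_sum_indic (A : 'I_n -> set R) (w m : 'I_n -> R) :
  (forall i, measurable (A i)) -> (forall i, A i `<=` D) ->
  (forall i, 0 <= w i) -> (forall i, mu (A i) = (m i)%:E) ->
  (\int[mu]_(x in D) (\sum_(i < n) w i * \1_(A i) x)%:E = (\sum_(i < n) w i * m i)%:E)%E.
Proof.
move=> mA AD w0 muA; under eq_integral do rewrite -sumEFin.
rewrite ge0_integral_sum//; last 2 first.
- move=> i; apply/measurable_EFinP; apply: measurable_funM => //.
  exact: measurable_indic (mA i).
- by move=> i x _; rewrite lee_fin mulr_ge0.
rewrite -sumEFin; apply: eq_bigr => i _.
under eq_integral do rewrite EFinM.
have mI : measurable_fun D (fun x => (\1_(A i) x : R)%:E).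
  by apply/measurable_EFinP; exact: measurable_indic (mA i).
rewrite ge0_integralZl ?lee_fin//.
transitivity ((w i)%:E * mu (A i))%E; last by rewrite muA.
congr (_ * _)%E; have := @integral_indic _ _ R mu D mD (A i) (mA i) => ->.
by congr (mu _); exact: setIidl.
Qed.

Lemma integral_step_fun (A : 'I_n -> set R) (w : 'I_n -> 'I_n -> R) (m : 'I_n -> R) :
  (forall i, measurable (A i)) -> (forall i, A i `<=` D) ->
  (forall i j, 0 <= w i j) -> (forall i, mu (A i) = (m i)%:E) ->
  (\int[mu]_(t in D) \int[mu]_(s in D) (step_fun A w t s)%:E =
   (\sum_(i < n) \sum_(j < n) w i j * m i * m j)%:E)%E.
Proof.
move=> mA AD w0 muA.
have m0 i : 0 <= m i by rewrite -lee_fin -muA measure_ge0.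
transitivity (\int[mu]_(t in D) (\sum_(i < n) (\sum_(j < n) w i j * m j) * \1_(A i) t)%:E)%E.
  apply: eq_integral => t _; rewrite (@integral_sum_indic A _ m)//; last first.
    by move=> j; rewrite sumr_ge0// => i _; rewrite mulr_ge0.
  congr EFin; under eq_bigr do rewrite mulr_suml.
  rewrite exchange_big; apply: eq_bigr => i _; rewrite mulr_suml.
  by apply: eq_bigr => j _; rewrite mulrAC.
rewrite (@integral_sum_indic A _ m)//; last first.
  by move=> i; rewrite sumr_ge0// => j _; rewrite mulr_ge0.
congr EFin; apply: eq_bigr => i _; rewrite mulr_suml.
by apply: eq_bigr => j _; rewrite mulrAC.
Qed.

Lemma step_fun_ge0 (A : 'I_n -> set R) (w : 'I_n -> 'I_n -> R) t s :
  (forall i j, 0 <= w i j) -> 0 <= step_fun A w t s.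
Proof.
move=> w0; rewrite sumr_ge0// => j _; rewrite mulr_ge0// sumr_ge0// => i _.
by rewrite mulr_ge0.
Qed.

(** By disjointness at most one term survives; off the cells the step function is 0 and f >= 0
    applies. *)
Lemma ge_step_fun (A : 'I_n -> set R) (w : 'I_n -> 'I_n -> R) (f : R -> R -> R) t s :
  (forall i j x, A i x -> A j x -> i = j) ->
  0 <= f t s -> (forall i j, A i t -> A j s -> w i j <= f t s) ->
  step_fun A w t s <= f t s.
Proof.
move=> Adisj f0 wf; have indic_eq i j x : A i x -> \1_(A j) x = (i == j)%:R :> R.
  move=> Ai; rewrite indicE; have [<-|ij] := eqVneq i j.
    by rewrite mem_set.
  by rewrite memNset// => /(Adisj _ _ _ Ai)/eqP; apply/negP.
have [[j Aj]|noj] := pselect (exists j, A j s); last first.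
  rewrite /step_fun big1// => j _; rewrite [X in _ * X]indicE memNset ?mulr0//.
  by move=> Aj; apply: noj; exists j.
have [[i Ai]|noi] := pselect (exists i, A i t); last first.
  rewrite /step_fun big1// => k _; rewrite big1 ?mul0r// => i _.
  by rewrite indicE memNset ?mulr0// => Ai; apply: noi; exists i.
rewrite /step_fun (bigD1 j)//= (indic_eq j)// eqxx mulr1 [X in _ + X]big1 => [|k kj].
  rewrite addr0 (bigD1 i)//= (indic_eq i)// eqxx mulr1 big1 ?addr0; first exact: wf.
  by move=> k ki; rewrite (indic_eq i)// eq_sym (negbTE ki) mulr0.
by rewrite (indic_eq j)// eq_sym (negbTE kj) mulr0.
Qed.

Lemma le_step_fun (A : 'I_n -> set R) (w : 'I_n -> 'I_n -> R) (f : R -> R -> R) t s i j :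
  (forall i j, 0 <= w i j) -> A i t -> A j s -> f t s <= w i j ->
  f t s <= step_fun A w t s.
Proof.
move=> w0 Ai Aj fw; apply: (le_trans fw); rewrite /step_fun (bigD1 j)//=.
rewrite indicE mem_set// mulr1 (bigD1 i)//= [\1_(A i) t]indicE mem_set// mulr1 -addrA lerDl.
rewrite addr_ge0 ?sumr_ge0// => k _; rewrite mulr_ge0// sumr_ge0// => k' _.
by rewrite mulr_ge0.
Qed.

End step_functions.

Section circle_cells.
Variables (R : realType) (L : R).
Hypothesis L0 : 0 < L.

Let mu := @lebesgue_measure R.

Definition circle_cell (beta u v : R) : set R :=
  [set t | 0 <= t < L /\ u <= Defs.arc L beta t < v].

(** In [0, L) an arc may wrap around the origin. Truncation by min and max covers all positions by
    two intervals, either of which may be empty. *)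
Lemma circle_cellE (beta u v : R) : 0 <= u <= v -> v <= L ->
  circle_cell beta u v =
  `[Num.min (Defs.arc L 0 beta + u) L, Num.min (Defs.arc L 0 beta + v) L[ `|`
  `[Num.max (Defs.arc L 0 beta + u - L) 0, Num.max (Defs.arc L 0 beta + v - L) 0[.
Proof.
move=> /andP[u0 uv] vL; have /andP[] := arc_bounds L0 0 beta.
set B := Defs.arc L 0 beta => B0 BL.
pose k := Num.floor ((beta - 0) / L).
have BE : B = beta - L * k%:~R by rewrite /B /Defs.arc -/k subr0.
have arcE t : 0 <= t < L -> Defs.arc L beta t = if B <= t then t - B else t - B + L.
  move=> /andP[t0 tL]; case: leP => Bt.
    by rewrite (@arc_unique _ _ L0 k); [rewrite BE; ring|rewrite BE in Bt BL *; apply/andP; split; lra].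
  rewrite (@arc_unique _ _ L0 (k + 1)) intrD rmorph1; first by rewrite BE; ring.
  by rewrite BE in Bt BL *; apply/andP; split; lra.
apply/seteqP; split => t /=.
  rewrite !in_itv/= => -[tL]; rewrite arcE//; move: tL => /andP[t0 tL] /andP[].
  case: (leP B t) => Bt h1 h2; [left|right]; apply/andP; split.
  - by rewrite ge_min; apply/orP; left; lra.
  - by rewrite lt_min tL andbT; lra.
  - by rewrite ge_max t0 andbT; lra.
  - by rewrite lt_max; apply/orP; left; lra.
rewrite !in_itv/= => -[|] /andP[].
  rewrite ge_min lt_min => /orP[h1|h1] /andP[h2 h3]; last by lra.
  have t0L : 0 <= t < L by apply/andP; split; lra.
  by split=> //; rewrite arcE// ifT; lra.
rewrite ge_max lt_max => /andP[h1 h2] /orP[h3|h3]; last by lra.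
have t0L : 0 <= t < L by apply/andP; split; lra.
by split=> //; rewrite arcE// ifF; last (apply/negP => ?); lra.
Qed.

Lemma measurable_circle_cell (beta u v : R) : 0 <= u <= v -> v <= L ->
  measurable (circle_cell beta u v).
Proof. by move=> uv vL; rewrite circle_cellE//; exact: measurableU. Qed.

Lemma measure_circle_cell (beta u v : R) : 0 <= u <= v -> v <= L ->
  mu (circle_cell beta u v) = (v - u)%:E.
Proof.
move=> uv vL; rewrite circle_cellE//; have /andP[] := arc_bounds L0 0 beta.
set B := Defs.arc L 0 beta => B0 BL; move: uv => /andP[u0 uv].
rewrite /mu measureU//=.
  rewrite !lebesgue_measure_itv/= !lte_fin.
  case: (leP (B + u) L) => h1; case: (leP (B + v) L) => h2;
  case: (leP (B + u - L) 0) => h3; case: (leP (B + v - L) 0) => h4;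
  case: ltP => h5; case: ltP => h6; rewrite -?EFinB ?add0e ?adde0 -?EFinD;
  congr EFin; lra.
rewrite -subset0 => t /=; rewrite !in_itv/= => -[/andP[h1 h2] /andP[h3 h4]].
move: h1 h4; rewrite ge_min lt_max => /orP[|] ? /orP[|] ?; move: h2 h3; rewrite lt_min ge_max => /andP[? ?] /andP[? ?]; lra.
Qed.

End circle_cells.

(** * Harmonic sums over pairs of vertices *)

Lemma sum_inv_le_ln (R : realType) (n : nat) : (0 < n)%N ->
  \sum_(1 <= k < n.+1) (k%:R : R)^-1 <= 1 + ln n%:R.
Proof.
elim: n => // n ih _; have [->|n0] := posnP n.
  by rewrite big_nat1 invr1 ln1 addr0.
rewrite big_nat_recr//= (le_trans (lerD (ih n0) (lexx _)))// -addrA lerD2l.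
have x0 : (0 : R) < n.+1%:R by rewrite ltr0n.
have nR : (0 : R) < n%:R by rewrite ltr0n.
(* The increment ln (n+1) - ln n = - ln (1 - 1/(n+1)) is at least 1/(n+1). *)
have : ln (1 - (n.+1%:R : R)^-1) <= - (n.+1%:R)^-1.
  by apply: le_ln1Dx; rewrite ltrN2 invf_lt1// ltr1n.
have -> : 1 - (n.+1%:R : R)^-1 = n%:R / n.+1%:R.
  by rewrite -natr1; field; rewrite natr1 pnatr_eq0.
rewrite ln_div ?posrE//.
by move: (ln n%:R) (ln n.+1%:R) (n.+1%:R^-1) => A B x; lra.
Qed.

(** With truncated subtraction the argument of [v] is |i - j|, and each value occurs at most once on
    either side of i. *)
Lemma sum_dist_le (R : numDomainType) (n : nat) (v : nat -> R) :
  (forall k, 0 <= v k) ->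
  \sum_(i < n) \sum_(j < n | i != j) v ((j - i) + (i - j))%N <=
  (2 * n)%:R * \sum_(1 <= k < n) v k.
Proof.
move=> v0; set S := \sum_(1 <= k < n) v k.
suff le_i (i : 'I_n) : \sum_(j < n | i != j) v ((j - i) + (i - j))%N <= 2 * S.
  rewrite (le_trans (ler_sum _ (fun i _ => le_i i)))//.
  by rewrite sumr_const card_ord natrM -mulrA -[leLHS]mulr_natl mulrCA.
have ni := ltn_ord i.
have part m : (m <= n)%N -> \sum_(1 <= k < m) v k <= S.
  have [->|m0] := posnP m; first by rewrite big_geq// sumr_ge0.
  by move=> mn; rewrite /S [leRHS](big_cat_nat (n := m))//= lerDl sumr_ge0.
have -> : \sum_(j < n | i != j) v ((j - i) + (i - j))%N =
    \sum_(0 <= j < n | (j != i :> nat)) v ((j - i) + (i - j))%N.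
  by rewrite big_mkord; apply: eq_bigl => j; rewrite eq_sym.
rewrite (big_cat_nat (n := i))//=; last exact: ltnW.
rewrite mulrDl mul1r lerD//.
  rewrite (le_trans _ (part i.+1 ni))//.
  rewrite big_mkcond big_nat_rev/= big_add1/=.
  rewrite le_eqVlt; apply/orP; left; apply/eqP; apply: eq_big_nat => j /andP[_ ji].
  rewrite add0n ltn_eqF; last by rewrite -subn_gt0 subKn// .
  by congr v; lia.
rewrite big_ltn_cond//= eqxx.
rewrite (le_trans _ (part (n - i)%N (leq_subr _ _)))//.
rewrite -[i.+1]add1n big_addn big_mkcond big_nat_cond [leRHS]big_nat_cond.
rewrite le_eqVlt; apply/orP; left; apply/eqP; apply: eq_bigr => k /andP[/andP[k0 _] _].
rewrite ifT; first by congr v; lia.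
by lia.
Qed.

(** The inverse of min(k, n - k) is at most 1/k + 1/(n - k). The factor 4 counts these two harmonic
    sums and the two sides of i. *)
Lemma sum_inv_dist_le (R : realType) (n : nat) (c : R) (D : 'I_n -> 'I_n -> R) :
  (1 < n)%N -> 0 < c -> (forall i j, D i j = D j i) ->
  (forall i j : 'I_n, (i < j)%N ->
    c / n%:R * Num.min (j - i)%:R (n - (j - i))%:R <= D i j) ->
  \sum_(i < n) \sum_(j < n | i != j) (D i j)^-1 <= 4 / c * n%:R ^+ 2 * (1 + ln n%:R).
Proof.
move=> n1 c0 DC Dmin.
have n0 : (0 < n)%N by exact: ltnW.
have nR : (0 : R) < n%:R by rewrite ltr0n.
pose v (k : nat) : R := n%:R / c * (k%:R^-1 + (n - k)%:R^-1).
have v0 k : 0 <= v k.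
  by rewrite mulr_ge0 ?addr_ge0 ?invr_ge0// divr_ge0// ltW.
have inv_le (i j : 'I_n) : (i < j)%N -> (D i j)^-1 <= v (j - i)%N.
  move=> ij; apply: (@le_trans _ _ (c / n%:R * Num.min (j - i)%:R (n - (j - i))%:R)^-1).
    have x0 : (0 : R) < (j - i)%:R by rewrite ltr0n subn_gt0.
    have y0 : (0 : R) < (n - (j - i))%:R.
      by rewrite ltr0n subn_gt0 (leq_ltn_trans (leq_subr _ _)).
    have m0 : 0 < c / n%:R * Num.min (j - i)%:R (n - (j - i))%:R.
      by rewrite mulr_gt0 ?divr_gt0// lt_min x0.
    by rewrite lef_pV2 ?posrE ?(lt_le_trans m0 (Dmin _ _ ij))// Dmin.
  rewrite invfM invf_div ler_wpM2l ?divr_ge0 ?(ltW c0)//.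
  by rewrite /Order.min; case: ifP => _; rewrite ?lerDl ?lerDr invr_ge0.
have step1 : \sum_(i < n) \sum_(j < n | i != j) (D i j)^-1 <=
    \sum_(i < n) \sum_(j < n | i != j) v ((j - i) + (i - j))%N.
  apply: ler_sum => i _; apply: ler_sum => j; rewrite neq_ltn => /orP[ij|ji].
    by rewrite (_ : (i - j = 0)%N) ?addn0 ?inv_le//; apply/eqP; rewrite subn_eq0 ltnW.
  have -> : (j - i = 0)%N by apply/eqP; rewrite subn_eq0 ltnW.
  by rewrite add0n DC inv_le.
have harm : \sum_(1 <= k < n) (k%:R : R)^-1 <= 1 + ln n%:R.
  by rewrite (le_trans _ (sum_inv_le_ln R n0))// big_nat_recr//= lerDl invr_ge0.
have harm' : \sum_(1 <= k < n) ((n - k)%:R : R)^-1 <= 1 + ln n%:R.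
  rewrite (le_trans _ harm)// big_nat_rev/= le_eqVlt; apply/orP; left; apply/eqP.
  by apply: eq_big_nat => k /andP[k1 kn]; congr (_%:R^-1); lia.
rewrite (le_trans step1)// (le_trans (sum_dist_le n v0))//.
rewrite /v -mulr_sumr big_split/= natrM.
rewrite [leRHS](_ : _ = 2 * n%:R * (n%:R / c * ((1 + ln n%:R) + (1 + ln n%:R)))).
  by rewrite ler_wpM2l ?mulr_ge0// ler_wpM2l ?divr_ge0 ?(ltW c0)// lerD.
by field; rewrite gt_eqF.
Qed.

(** Uses 1 <= x^e and e ln x = ln (x^e) <= x^e. *)
Lemma ln_le_powR (R : realType) (x e : R) : 1 <= x -> 0 < e ->
  1 + ln x <= (1 + e^-1) * x `^ e.
Proof.
move=> x1 e0; have x0 : 0 < x by exact: lt_le_trans x1.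
have p1 : 1 <= x `^ e by rewrite -(powRr0 x) ler_powR// ltW.
rewrite mulrDl mul1r lerD// mulrC ler_pdivlMr// mulrC -ln_powR ltW// ln_sublinear//.
exact: powR_gt0.
Qed.

(** * The Riemann sum of the energy *)

Section subdivision_cells.
Variables (R : realType) (L : R) (n : nat) (b : 'I_n -> R).
Hypothesis L0 : 0 < L.
Hypothesis n1 : (1 < n)%N.
Hypothesis b_sub : subdivision L b.

Let i0 : 'I_n := Ordinal (ltnW n1).
(** Positions are measured from the first point of the subdivision, so that the cells [u k, v k)
    tile [0, L) without wrapping. *)
Let u k := b k - b i0.
Let v k := u k + cyclic_step L b k.

Let step_gt0 k : 0 < cyclic_step L b k.
Proof. by have [] := subdivision_arc_step k L0 n1 b_sub. Qed.

Lemma subdivision_cell_bounds k : 0 <= u k <= v k /\ v k <= L.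
Proof.
rewrite /v lerDl (ltW (step_gt0 k)) andbT /u; have [bm bp] := b_sub.
split.
  rewrite subr_ge0; have [->//|k0] := eqVneq k i0.
  by rewrite ltW// bm// lt0n; apply: contra k0 => /eqP h; apply/eqP/val_inj.
rewrite /cyclic_step; have [kn|kn] := eqVneq k.+1 n.
  have -> : ordS k = i0 by apply: val_inj; rewrite /= kn modnn.
  by rewrite mulr1n; lra.
by have := bp i0 (ordS k); rewrite mulr0n; lra.
Qed.

Let cell_le (i j : 'I_n) : (i < j)%N -> v i <= u j.
Proof.
move=> ij; have iS : (i.+1 < n)%N by apply: leq_ltn_trans (ltn_ord j).
rewrite /v /u /cyclic_step (ltn_eqF iS) mulr0n addr0.
have [->|Sj] := eqVneq (ordS i) j; first by lra.
have : b (ordS i) < b j.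
  apply: b_sub.1; rewrite ltn_neqAle /= modn_small// ij andbT.
  by apply: contra Sj => /eqP h; apply/eqP/val_inj; rewrite /= modn_small.
by lra.
Qed.

Lemma subdivision_cell_disjoint i j x :
  u i <= x < v i -> u j <= x < v j -> i = j.
Proof.
move=> /andP[h1 h2] /andP[h3 h4]; apply/eqP/negPn/negP; rewrite neq_ltn.
by move=> /orP[] /cell_le; lra.
Qed.

Lemma subdivision_cell_cover x : 0 <= x < L -> exists k, u k <= x < v k.
Proof.
move=> /andP[x0 xL]; have ui0 : u i0 <= x by rewrite /u subrr.
(* The cell sought is the one of the last point not beyond x; the last cell of all ends at L. *)
case: (@arg_maxnP _ i0 (fun k => u k <= x) val ui0) => k uk kmax.
exists k; rewrite uk ltNge; apply/negP => vx.
have [kn|kn] := eqVneq k.+1 n.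
  have E : ordS k = i0 by apply: val_inj; rewrite /= kn modnn.
  by move: vx; rewrite /v /u /cyclic_step E kn eqxx mulr1n; lra.
have kn' : (k.+1 < n)%N by rewrite ltn_neqAle kn ltn_ord.
have ux : u (ordS k) <= x.
  by move: vx; rewrite /v /u /cyclic_step (negbTE kn) mulr0n; lra.
by have := kmax _ ux; rewrite /= modn_small// ltnn.
Qed.

End subdivision_cells.

Section closed_cells.
Variables (R : realType) (L : R).
Hypothesis L0 : 0 < L.

(* The variant of [circle_cell] that also contains the point [L]: these cells
   cover the closed interval of integration, at the cost of disjointness. *)
Definition closed_circle_cell (beta u v : R) : set R :=
  [set t | 0 <= t <= L /\ u <= Defs.arc L beta t < v].

(** At most the null set {L} is added to the half-open cell. *)
Lemma closed_circle_cellE (beta u v : R) : 0 <= u <= v -> v <= L ->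
  measurable (closed_circle_cell beta u v) /\
  lebesgue_measure (closed_circle_cell beta u v) = (v - u)%:E.
Proof.
move=> uv vL; have mC := measurable_circle_cell L0 beta uv vL.
have muC := measure_circle_cell L0 beta uv vL.
have [hL|hL] := pselect (u <= Defs.arc L beta L < v).
  have -> : closed_circle_cell beta u v = circle_cell L beta u v `|` [set L].
    apply/seteqP; split => t /=.
      move=> [/andP[t0]]; rewrite le_eqVlt => /orP[/eqP ->|tL] h; [by right|left].
      by split=> //; rewrite t0.
    move=> [[/andP[t0 tL] h]|->]; split=> //; first by rewrite t0 ltW.
    by rewrite lexx ltW.
  split; first exact: measurableU.
  rewrite measureU//.
    transitivity ((v - u)%:E + 0)%E; last by rewrite adde0.
    by congr (_ + _)%E; [exact: muC|exact: lebesgue_measure_set1].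
  by rewrite -subset0 => t /= [[/andP[_ tL] _] tE]; move: tL; rewrite tE ltxx.
suff -> : closed_circle_cell beta u v = circle_cell L beta u v by [].
apply/seteqP; split => t /= [/andP[t0 tL] h]; split=> //; rewrite t0/=; last exact: ltW.
by rewrite lt_neqAle tL andbT; apply/eqP => tE; apply: hL; move: h; rewrite tE.
Qed.

End closed_cells.

(** Two real bounds exclude infinite values, so finiteness of the energy is a by-product. *)
Lemma abse_sub_le (R : realType) (I : \bar R) (S E : R) :
  ((S - E)%:E <= I)%E -> (I <= (S + E)%:E)%E -> (`|I - S%:E| <= E%:E)%E.
Proof.
case: I => [x| |]; rewrite ?lee_fin//.
by move=> h1 h2; rewrite ler_norml; apply/andP; split; lra.
Qed.

Section riemann_sum.
Variables (R : realType) (L : R) (F : R -> R -> R) (M A h : R).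
Hypothesis L0 : 0 < L.
Hypothesis F_bounds : forall t s, 0 <= F t s <= M.
Hypothesis F_periodic : forall (k m : int) t s,
  F (t + L * k%:~R) (s + L * m%:~R) = F t s.
Hypothesis A0 : (0 : R) <= A.
Hypothesis F_lip : forall t s t' s', `|t' - t| <= h -> `|s' - s| <= h ->
  0 < circle_dist L t s -> `|F t' s' - F t s| <= A * (h / circle_dist L t s).
Variables (n : nat) (b : 'I_n -> R).
Hypothesis n1 : (1 < n)%N.
Hypothesis b_sub : subdivision L b.
Hypothesis step_le_h : forall k, cyclic_step L b k <= h.
Hypothesis dist_gt0 : forall i j, i != j -> 0 < circle_dist L (b i) (b j).

Let i0 : 'I_n := Ordinal (ltnW n1).
Let Del := cyclic_step L b.
Let u k := b k - b i0.
Let v k := u k + Del k.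
Let D i j := circle_dist L (b i) (b j).
Let err i j := A * (h / D i j).
(** The Lipschitz bound says nothing at distance 0, so diagonal cells take the extreme values 0 and
    M. The maximum with 0 keeps the lower step function nonnegative. *)
Let lower i j := if i == j then 0 else Num.max 0 (F (b i) (b j) - err i j).
Let upper i j := if i == j then M else F (b i) (b j) + err i j.
Let mu := @lebesgue_measure R.
Let I01 : set R := `[0, L].

Let Del_gt0 k : 0 < Del k.
Proof. by have [] := subdivision_arc_step k L0 n1 b_sub. Qed.

Let h0 : 0 <= h.
Proof. by rewrite (le_trans _ (step_le_h i0))// ltW// Del_gt0. Qed.

Let M0 : 0 <= M.
Proof. by have /andP[h1 h2] := F_bounds 0 0; apply: le_trans h2. Qed.

Let err_ge0 i j : i != j -> 0 <= err i j.
Proof. by move=> ij; rewrite mulr_ge0// divr_ge0// ltW// dist_gt0. Qed.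

(** [F_lip] measures displacements on the line, so a point of the cell is replaced by its
    representative near [b k]. *)
Let cell_lift k t : u k <= Defs.arc L (b i0) t < v k ->
  exists2 tau, `|tau - b k| <= h & exists m : int, t = tau + L * m%:~R.
Proof.
move=> /andP[h1 h2]; exists (b i0 + Defs.arc L (b i0) t).
  have := step_le_h k; rewrite -/(Del k) => h3.
  have -> : b i0 + Defs.arc L (b i0) t - b k = Defs.arc L (b i0) t - u k by rewrite /u; ring.
  by rewrite ger0_norm ?subr_ge0//; rewrite /v in h2; lra.
by exists (Num.floor ((t - b i0) / L)); rewrite /Defs.arc; ring.
Qed.

Let cell_bounds i j t s : u i <= Defs.arc L (b i0) t < v i ->
  u j <= Defs.arc L (b i0) s < v j -> lower i j <= F t s <= upper i j.
Proof.
move=> /cell_lift[tau tauh [k ->]] /cell_lift[sig sigh [m ->]]; rewrite F_periodic.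
have /andP[F0 FM] := F_bounds tau sig.
rewrite /lower /upper; have [_|ij] := eqVneq i j; first by rewrite F0.
have := F_lip tauh sigh (dist_gt0 ij); rewrite -/(D i j) -/(err i j) ler_norml.
by move=> /andP[h1 h2]; rewrite ge_max F0/=; apply/andP; split; lra.
Qed.

Let lower_ge0 i j : 0 <= lower i j.
Proof. by rewrite /lower; case: eqP => // _; rewrite le_max lexx. Qed.

Let upper_ge0 i j : 0 <= upper i j.
Proof.
rewrite /upper; have [//|ij] := eqVneq i j.
by rewrite addr_ge0 ?err_ge0//; have /andP[] := F_bounds (b i) (b j).
Qed.

Let cellsP k := subdivision_cell_bounds L0 n1 b_sub k.

Let Del_cell k : v k - u k = Del k.
Proof. by rewrite /v addrAC subrr add0r. Qed.

Let sum_lower : ((\sum_(i < n) \sum_(j < n) lower i j * Del i * Del j)%:E <=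
  \int[mu]_(t in I01) \int[mu]_(s in I01) (F t s)%:E)%E.
Proof.
(* These cells leave out the point L, where the lower step function is 0. *)
pose C k := circle_cell L (b i0) (u k) (v k).
have CD k : C k `<=` I01.
  by move=> t [/andP[t0 tL] _]; rewrite /I01/= in_itv/= t0 ltW.
have mC k : measurable (C k).
  by have [uv vL] := cellsP k; exact: measurable_circle_cell.
have muC k : lebesgue_measure (C k) = (Del k)%:E.
  by have [uv vL] := cellsP k; rewrite -Del_cell; exact: measure_circle_cell.
rewrite -(integral_step_fun (measurable_itv _) mC CD lower_ge0 muC).
have step0 t s : 0 <= step_fun C lower t s by exact: step_fun_ge0.
apply: le_integral_nomeas => t _.
  by apply: integral_ge0 => s _; rewrite lee_fin.
apply: le_integral_nomeas => s _; rewrite lee_fin//.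
apply: ge_step_fun => [i j x [_ Ci] [_ Cj]||i j [_ Ci] [_ Cj]].
- exact: subdivision_cell_disjoint Ci Cj.
- by have /andP[] := F_bounds t s.
- by have /andP[] := cell_bounds Ci Cj.
Qed.

Let sum_upper : (\int[mu]_(t in I01) \int[mu]_(s in I01) (F t s)%:E <=
  (\sum_(i < n) \sum_(j < n) upper i j * Del i * Del j)%:E)%E.
Proof.
pose C k := closed_circle_cell L (b i0) (u k) (v k).
have CD k : C k `<=` I01 by move=> t [tL _]; rewrite /I01/= in_itv/=.
have mC k : measurable (C k).
  by have [uv vL] := cellsP k; have [] := closed_circle_cellE L0 (b i0) uv vL.
have muC k : lebesgue_measure (C k) = (Del k)%:E.
  have [uv vL] := cellsP k; rewrite -Del_cell.
  by have [] := closed_circle_cellE L0 (b i0) uv vL.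
rewrite -(integral_step_fun (measurable_itv _) mC CD upper_ge0 muC).
have cover t : I01 t -> exists k, C k t.
  rewrite /I01/= in_itv/= => tL.
  have [k kP] := subdivision_cell_cover b n1 (arc_bounds L0 (b i0) t).
  by exists k.
apply: le_integral_nomeas => t It.
  by apply: integral_ge0 => s _; rewrite lee_fin; have /andP[] := F_bounds t s.
apply: le_integral_nomeas => s Is; rewrite lee_fin.
  by have /andP[] := F_bounds t s.
have [i Ci] := cover t It; have [j Cj] := cover s Is.
apply: (le_step_fun (i := i) (j := j)) => //.
by case: Ci Cj => _ Ci [_ Cj]; have /andP[] := cell_bounds Ci Cj.
Qed.

Let S := \sum_(i < n) \sum_(j < n | i != j) F (b i) (b j) * Del i * Del j.
Let E := A * h ^+ 3 * (\sum_(i < n) \sum_(j < n | i != j) (D i j)^-1) + n%:R * M * h ^+ 2.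

Lemma riemann_sum_error :
  ((S - E)%:E <= \int[mu]_(t in I01) \int[mu]_(s in I01) (F t s)%:E)%E /\
  (\int[mu]_(t in I01) \int[mu]_(s in I01) (F t s)%:E <= (S + E)%:E)%E.
Proof.
have Dh i j : 0 <= Del i * Del j <= h ^+ 2.
  by rewrite mulr_ge0 ?(ltW (Del_gt0 _))//= expr2 ler_pM ?(ltW (Del_gt0 _))// step_le_h.
have errD i j : i != j -> err i j * Del i * Del j <= A * h ^+ 3 * (D i j)^-1.
  move=> ij; have /andP[_ h2] := Dh i j.
  rewrite -mulrA (le_trans (ler_wpM2l (err_ge0 ij) h2))// /err.
  by rewrite le_eqVlt; apply/orP; left; apply/eqP; ring.
pose x i j := if i != j then F (b i) (b j) * Del i * Del j else 0.
pose y i j := if i != j then A * h ^+ 3 * (D i j)^-1 else 0.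
pose z (i j : 'I_n) := if i == j then M * h ^+ 2 else 0.
have SE : S = \sum_(i < n) \sum_(j < n) x i j.
  by apply: eq_bigr => i _; rewrite big_mkcond.
have EE : E = \sum_(i < n) \sum_(j < n) (y i j + z i j).
  under eq_bigr do rewrite big_split; rewrite big_split/=; congr (_ + _).
    rewrite mulr_sumr; apply: eq_bigr => i _; rewrite mulr_sumr big_mkcond/=.
    by apply: eq_bigr => j _; rewrite /y.
  rewrite (eq_bigr (fun=> M * h ^+ 2)) => [|i _].
    by rewrite sumr_const card_ord -[RHS]mulr_natl mulrA.
  rewrite (bigD1 i)//= /z eqxx big1 ?addr0// => j.
  by rewrite eq_sym => /negbTE ->.
have Mh : 0 <= M * h ^+ 2 by rewrite mulr_ge0// sqr_ge0.
split.
  apply: le_trans sum_lower; rewrite lee_fin SE EE -sumrB ler_sum// => i _.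
  rewrite -sumrB ler_sum// => j _; rewrite /x /y /z /lower.
  have [ij|ij] /= := eqVneq i j; first by rewrite !mul0r; lra.
  have /andP[D0 _] := Dh i j; have := errD i j ij.
  have : (F (b i) (b j) - err i j) * (Del i * Del j) <=
      Num.max 0 (F (b i) (b j) - err i j) * (Del i * Del j).
    by rewrite ler_wpM2r// le_max lexx orbT.
  rewrite !mulrA; lra.
apply: (le_trans sum_upper); rewrite lee_fin SE EE -big_split ler_sum// => i _.
rewrite -big_split ler_sum// => j _; rewrite /x /y /z /upper.
have [<-|ij] /= := eqVneq i j.
  by rewrite !add0r -mulrA ler_wpM2l//; have /andP[] := Dh i i.
by have := errD i j ij; lra.
Qed.

End riemann_sum.

(** * The energy estimate *)

Theorem proposition3 (R : realType) (d : nat) (L : R) (gamma : R -> 'rV[R]_d)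
    (c cbar : R) :
  0 < L ->
  C11_closed_curve L gamma ->
  arclength_parametrised gamma ->
  simple_closed L gamma ->
  0 < c -> 0 < cbar ->
  forall eps : R, 0 < eps < 1 ->
  exists2 C : R, 0 < C &
    forall (n : nat) (b : 'I_n -> R) (p : R -> 'rV[R]_d) (a : 'I_n -> R),
      (0 < n)%N ->
      subdivision L b ->
      (forall k : 'I_n,
         c / n%:R <= enorm (gamma (b (ordS k)) - gamma (b k)) <= cbar / n%:R) ->
      inscribed_polygon gamma b p a ->
      (`| mobius_energy L gamma
          - (discrete_mobius_energy (inscribed_length gamma b) p a)%:E |
       <= (C / n%:R `^ (1 - eps))%:E)%E.
Proof.
move=> L0 [per der [K lip]] arclen simple c0 cbar0 eps /andP[eps0 eps1].
pose H : R := d%:R * K ^+ 2.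
have H0 : 0 <= H := lip_const_ge0 d K.
have phi_bounds := chord_defect_bounds der lip arclen.
have phi_lip := chord_defect_lip der lip arclen.
have [k k0 k_chord] := chord_ge_circle_dist L0 per der simple H0 phi_bounds.
have [A A0 F_lip] := mobius_integrand_lip L0 per H0 phi_bounds phi_lip k0 k_chord.
have F_bounds := mobius_integrand_bounds L0 per H0 phi_bounds k0 k_chord.
have kappa0 : 0 < Num.sqrt k by rewrite sqrtr_gt0.
have kappa_chord t s : Num.sqrt k * circle_dist L t s <= enorm (gamma t - gamma s).
  have D0 := circle_dist_ge0 L0 t s.
  rewrite -ler_sqr ?nnegrE ?enorm_ge0 ?mulr_ge0 ?sqrtr_ge0//.
  by rewrite exprMn sqr_sqrtr ?(ltW k0).
pose M := H / k; pose C1 := cbar / Num.sqrt k * (1 + 2 * L / c).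
have M0 : 0 <= M by rewrite divr_ge0// ltW.
have C10 : 0 <= C1.
  by rewrite mulr_ge0 ?divr_ge0 ?addr_ge0 ?divr_ge0 ?mulr_ge0 ?(ltW L0) ?(ltW c0)
    ?(ltW cbar0) ?(ltW kappa0).
pose C2 := 2 * M * (H * C1 ^+ 2 + (2 * C1 / L) ^+ 2) * C1 ^+ 2 * L + 2 * H * C1 ^+ 6 / c ^+ 3.
have E0 : 0 <= H * C1 ^+ 2 + (2 * C1 / L) ^+ 2.
  exact: addr_ge0 (mulr_ge0 H0 (sqr_ge0 _)) (sqr_ge0 _).
have C20 : 0 <= C2.
  apply: addr_ge0.
    exact: mulr_ge0 (mulr_ge0 (mulr_ge0 (mulr_ge0 (ler0n _ 2) M0) E0) (sqr_ge0 _)) (ltW L0).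
  apply: divr_ge0; last exact: exprn_ge0 (ltW c0).
  exact: mulr_ge0 (mulr_ge0 (ler0n _ 2) H0) (exprn_ge0 6 C10).
(* [A * C1 ^+ 3] and [M * C1 ^+ 2] come from the Riemann sum with h = C1/n, [C2] from the polygon
   terms, and 4/c from the sum of inverse distances. *)
pose C3 := (A * C1 ^+ 3 + C2) * (4 / c) + M * C1 ^+ 2.
have q0 : 0 <= A * C1 ^+ 3 + C2.
  exact: addr_ge0 (mulr_ge0 (ltW A0) (exprn_ge0 3 C10)) C20.
have MC0 : 0 <= M * C1 ^+ 2 := mulr_ge0 M0 (sqr_ge0 _).
have C30 : 0 <= C3.
  exact: addr_ge0 (mulr_ge0 q0 (divr_ge0 (ler0n _ 4) (ltW c0))) MC0.
(* The summand 1 gives strict positivity from [0 <= C3]. *)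
exists (C3 * (1 + eps^-1) + 1).
  by rewrite ltr_wpDl// (mulr_ge0 C30)// addr_ge0// invr_ge0 ltW.
move=> n b p a n0 b_sub edges pP.
have n1 := polygon_size_gt1 c0 n0 edges.
have nR : (0 : R) < n%:R by rewrite ltr0n.
have n1R : (1 : R) <= n%:R by rewrite ler1n.
pose F := mobius_integrand L gamma; pose D i j := circle_dist L (b i) (b j).
have D0 i j : i != j -> 0 < D i j.
  move=> ij; apply: lt_le_trans (polygon_dist_min L0 per phi_bounds c0 n0 b_sub edges ij).
  by rewrite divr_gt0.
have steps i := arc_le L0 per phi_bounds kappa0 kappa_chord c0 cbar0 n0 b_sub edges i.
pose X := \sum_(i < n) \sum_(j < n | i != j) (D i j)^-1.
pose ell : R := 1 + ln n%:R.
have ell1 : 1 <= ell by rewrite lerDl ln_ge0.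
have X_le : X <= 4 / c * n%:R ^+ 2 * ell.
  apply: sum_inv_dist_le => // [i j|i j ij]; first exact: circle_distC.
  by have := polygon_dist_lower L0 per phi_bounds c0 n0 b_sub edges ij.
pose S := \sum_(i < n) \sum_(j < n | i != j)
  F (b i) (b j) * cyclic_step L b i * cyclic_step L b j.
pose err := A * (C1 / n%:R) ^+ 3 * X + n%:R * M * (C1 / n%:R) ^+ 2.
have [low up] : ((S - err)%:E <= mobius_energy L gamma)%E /\
    (mobius_energy L gamma <= (S + err)%:E)%E.
  exact: (riemann_sum_error L0 F_bounds (mobius_integrand_shift L0 per)
    (ltW A0) (F_lip (C1 / n%:R)) n1 b_sub steps D0).
pose En := discrete_mobius_energy (inscribed_length gamma b) p a; rewrite -/En.
have SEn : `|En - S| <= C2 / n%:R ^+ 3 * X.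
  rewrite /En /S /discrete_mobius_energy -sumrB (le_trans (ler_norm_sum _ _ _))//.
  rewrite mulr_sumr ler_sum// => i _.
  rewrite -sumrB (le_trans (ler_norm_sum _ _ _))// mulr_sumr ler_sum// => j ij.
  have FM := F_bounds (b j) (b i).
  have := polygon_term_error L0 per H0 phi_bounds kappa0 kappa_chord c0 cbar0
    n0 b_sub edges pP M0 ij FM.
  (* The discrete energy evaluates at (j, i), the Riemann sum at (i, j); the integrand is
     symmetric. *)
  rewrite -[_ - circle_dist L _ _ ^- 2]/(F (b j) (b i)) /F mobius_integrandC//.
  move=> /le_trans; apply.
  by rewrite /D (circle_distC L0 (b i)) -[leRHS]mulrA -invfM; exact: lexx.
have total : err + C2 / n%:R ^+ 3 * X <=
    (C3 * (1 + eps^-1) + 1) / n%:R `^ (1 - eps).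
  apply: (@le_trans _ _ (C3 * ell / n%:R)).
    have -> : err + C2 / n%:R ^+ 3 * X =
        ((A * C1 ^+ 3 + C2) / n%:R ^+ 3) * X + M * C1 ^+ 2 / n%:R.
      by rewrite /err; field; rewrite gt_eqF.
    have e1 : ((A * C1 ^+ 3 + C2) / n%:R ^+ 3) * X <=
        ((A * C1 ^+ 3 + C2) / n%:R ^+ 3) * (4 / c * n%:R ^+ 2 * ell).
      by rewrite ler_wpM2l// divr_ge0 ?exprn_ge0.
    have e2 : M * C1 ^+ 2 / n%:R <= M * C1 ^+ 2 / n%:R * ell.
      by rewrite ler_peMr// divr_ge0.
    rewrite (le_trans (lerD e1 e2))// le_eqVlt; apply/orP; left; apply/eqP.
    by rewrite /C3; field; rewrite !gt_eqF.
  have pn : 0 < n%:R `^ (1 - eps) by exact: powR_gt0.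
  rewrite ler_pdivlMr// mulrAC ler_pdivrMr//.
  have nE : n%:R = n%:R `^ eps * n%:R `^ (1 - eps) :> R.
    by rewrite -powRD ?subrKC ?powRr1 ?(ltW nR)// gt_eqF ?implybT.
  have ell_le := ln_le_powR n1R eps0; rewrite -/ell in ell_le.
  apply: (@le_trans _ _ (C3 * ((1 + eps^-1) * n%:R `^ eps) * n%:R `^ (1 - eps))).
    by rewrite ler_pM2r// ler_wpM2l.
  rewrite [leRHS]mulrDl mul1r [X in _ <= _ * X + _]nE -!mulrA lerDl ltW//.
move: SEn; rewrite ler_norml => /andP[SE ES].
apply: abse_sub_le; [apply: le_trans low|apply: (le_trans up)]; rewrite lee_fin; lra.
Qed.
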